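(* Let $p\ge1$ and let $(X,d,\mathfrak m)$ be a metric measure space (possibly non-complete). Then $(X,d,\mathfrak m)$ satisfies a $p$-Poincaré inequality for all couples $(u,\mathrm{lip}\,u)$, where $u\in\mathrm{Lip}(X)$, if and only if it satisfies a $p$-Poincaré inequality for all couples $(u,g)$, where $u:X\to\mathbb R$ is Borel and $g\in\mathrm{UG}^\varepsilon(u)$ for some $\varepsilon>0$, with the same constants. Moreover, this happens if and only if the metric completion $(\bar X,\bar d,\bar{\mathfrak m})$ satisfies a $p$-Poincaré inequality for all couples $(u,\mathrm{lip}\,u)$, where $u\in\mathrm{Lip}(\bar X)$.
   Context: A metric measure space $(X,d,\mathfrak m)$ is a separable metric space $(X,d)$ (not necessarily complete) with a non-trivial outer measure $\mathfrak m$ which is Radon and finite on bounded sets. Its completion is $(\bar X,\bar d,\bar{\mathfrak m})$, where $(\bar X,\bar d)$ is the metric completion of $(X,d)$ and $\bar{\mathfrak m}(E):=\mathfrak m(E\cap X)$ for $E\subseteq\bar X$. A $p$-Poincaré inequality for a class of couples $(u,g)$, with constants $C,\lambda\ge1$ (the same for all couples in the class), means that $$\frac1{\mathfrak m(B_r(x))}\int_{B_r(x)}\Big|u-\frac1{\mathfrak m(B_r(x))}\int_{B_r(x)}u\,d\mathfrak m\Big|\,d\mathfrak m\le C\,r\Big(\frac1{\mathfrak m(B_{\lambda r}(x))}\int_{B_{\lambda r}(x)}g^p\,d\mathfrak m\Big)^{1/p}$$ for every ball $B_r(x)\subseteq X$ and every couple $(u,g)$ in the class. ''With the same constants'' means that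 the pair $(C,\lambda)$ can be taken the same in the two properties. $\mathrm{Lip}(X)$ is the set of Lipschitz functions $X\to\mathbb R$ and $\mathrm{lip}\,u(x):=\lim_{\varepsilon\to0}\sup_{y\in B_\varepsilon(x),\,y\ne x}\frac{|u(y)-u(x)|}{d(x,y)}$ (equal to $0$ at isolated points). For $\varepsilon>0$, an $\varepsilon$-chain is a finite sequence of points $c=\{q_i\}_{i=0}^N$ of $X$ with $d(q_i,q_{i+1})\le\varepsilon$ for all $i$; $\alpha(c)=q_0$, $\omega(c)=q_N$. For $g:X\to[0,+\infty]$, $\int_c g:=\sum_{i=0}^{N-1}\frac{g(q_i)+g(q_{i+1})}{2}d(q_i,q_{i+1})$ (with $0\cdot\infty=0$). A Borel function $g:X\to[0,+\infty]$ belongs to $\mathrm{UG}^\varepsilon(u)$ if $|u(\omega(c))-u(\alpha(c))|\le\int_c g$ for every $\varepsilon$-chain $c$. *)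

(* Defs.v *)
From HB Require Import structures.
From mathcomp Require Import all_boot all_order all_algebra.
From mathcomp Require Import all_classical all_reals all_analysis.
From mathcomp Require Import measurable_realfun.
Import Order.TTheory GRing.Theory Num.Theory.
Import numFieldNormedType.Exports.

Set Implicit Arguments.
Unset Strict Implicit.
Unset Printing Implicit Defensive.

Local Open Scope classical_set_scope.
Local Open Scope ring_scope.

(* Measurable types are pointed in the library.  Asking for a point is no
   restriction here: a space carrying a nonzero outer measure is nonempty. *)
#[short(type="pmetricType")]
HB.structure Definition PointedMetric (K : numDomainType) :=
  {M of Metric K M & isPointed M}.

#[short(type="completeMetricType")]
HB.structure Definition CompleteMetric (K : numDomainType) :=
  {M of Metric K M & Complete M}.

Section metric_measure_space.
Context {R : realType} {X : pmetricType R}.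
Implicit Types (mu : {outer_measure set X -> \bar R}) (u : X -> R).
Implicit Types (g : X -> \bar R).
Local Open Scope ereal_scope.

Definition separable_space := exists2 D : set X, countable D & dense D.

(* Radon outer measures on metric spaces in the sense of Mattila (Geometry of
   Sets and Measures in Euclidean Spaces, Definition 1.5).  As X need not be
   complete, radon_inner does not follow from the other clauses. *)
Record radon mu : Prop := Radon {
  radon_borel : forall A : set X, <<s @open X >> A -> mu.-caratheodory A;
  radon_compact : forall K : set X, compact K -> mu K < +oo;
  radon_inner : forall U : set X, open U ->
    mu U = ereal_sup [set mu K | K in [set K | compact K /\ K `<=` U]];
  radon_outer : forall A : set X,
    mu A = ereal_inf [set mu U | U in [set U | open U /\ A `<=` U]] }.

Record metric_measure_space mu : Prop := MetricMeasureSpace {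
  mms_separable : separable_space;
  mms_nontrivial : mu [set: X] != 0;
  mms_radon : radon mu;
  mms_bounded : forall (A : set X) (x : X) (r : R),
    A `<=` ball x r -> mu A < +oo }.

(* The integral is taken over the Caratheodory sigma-algebra of mu, on which mu
   is a measure; it contains the Borel sets when mu is Radon.  If mu A = 0 the
   average is 0, by the convention 0 * +oo = 0. *)
Definition average mu (A : set X) (f : X -> \bar R) : \bar R :=
  (mu A)^-1 *
  \int[(mu : set (caratheodory_type mu) -> \bar R)]_(x in A) f x.

(* If u is not integrable on the ball, its average is infinite (the library
   sets +oo - +oo = -oo) and so is the left-hand side, unless the ball is
   null. *)
Definition poincare mu (p : R) (F : set ((X -> R) * (X -> \bar R)))
    (C lambda : R) : Prop :=
  [/\ (1 <= C)%R, (1 <= lambda)%R &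
    forall u g, F (u, g) -> forall (x : X) (r : R), (0 < r)%R ->
      average mu (ball x r)
        (fun y => `|(u y)%:E - average mu (ball x r) (EFin \o u)|)
      <= (C * r)%:E *
         (average mu (ball x (lambda * r)) (fun y => g y `^ p)) `^ p^-1].

Definition lipschitz_fun u : Prop :=
  exists L : R, forall x y, (`|u x - u y| <= L * mdist x y)%R.

Definition lip u (x : X) : \bar R :=
  if `[< isolated [set: X] x >] then 0
  else lim (ereal_sup [set (`|u y - u x| / mdist x y)%:E | y in ball x e `\ x]
            @[e --> (0 : R)^'+]).

Definition lip_couples : set ((X -> R) * (X -> \bar R)) :=
  [set ug | lipschitz_fun ug.1 /\ ug.2 = lip ug.1].

Definition borel_fun d (T : measurableType d) (f : X -> T) : Prop :=
  measurable_fun [set: g_sigma_algebraType (@open X)] f.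

(* The chain q 0, ..., q N; the values of q beyond N are irrelevant. *)
Definition is_chain (eps : R) (N : nat) (q : nat -> X) : Prop :=
  forall i, (i < N)%N -> (mdist (q i) (q i.+1) <= eps)%R.

Definition chain_integral g (N : nat) (q : nat -> X) : \bar R :=
  \sum_(i < N) (g (q i) + g (q i.+1)) / 2%:E * (mdist (q i) (q i.+1))%:E.

Definition UG (eps : R) u : set (X -> \bar R) :=
  [set g : X -> \bar R | [/\ borel_fun g, forall x, 0 <= g x &
    forall N q, is_chain eps N q ->
      `|u (q N) - u (q 0%N)|%:E <= chain_integral g N q]].

Definition UG_couples : set ((X -> R) * (X -> \bar R)) :=
  [set ug | borel_fun ug.1 /\ exists2 eps : R, (0 < eps)%R & UG eps ug.1 ug.2].

End metric_measure_space.

Section completion.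
Context {R : realType} {X : pmetricType R}.

(* The metric completion of X is unique up to isometry; it is a complete space
   Y with an isometric embedding of X whose image is dense. *)
Definition is_completion (Y : completeMetricType R) (i : X -> Y) : Prop :=
  (forall x y, mdist (i x) (i y) = mdist x y) /\ dense (range i).

Definition completion_measure (mu : {outer_measure set X -> \bar R})
  (Y : completeMetricType R) (i : X -> Y) (E : set Y) : \bar R :=
  mu (i @^-1` E).

Section outer_measure.
Variables (mu : {outer_measure set X -> \bar R}).
Variables (Y : completeMetricType R) (i : X -> Y).
Local Notation nu := (completion_measure mu i).
Local Open Scope ereal_scope.

Let nu0 : nu set0 = 0.
Proof. by rewrite /completion_measure preimage_set0 outer_measure0. Qed.

Let nu_ge0 E : 0 <= nu E.
Proof. exact: outer_measure_ge0. Qed.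

Let le_nu : {homo nu : A B / A `<=` B >-> A <= B}.
Proof. by move=> A B AB; apply: le_outer_measure; exact: preimage_subset. Qed.

Let nu_sigma_subadditive : sigma_subadditive nu.
Proof.
move=> A; rewrite /completion_measure preimage_bigcup.
exact: outer_measure_sigma_subadditive.
Qed.

HB.instance Definition _ := isOuterMeasure.Build R Y nu
  nu0 nu_ge0 le_nu nu_sigma_subadditive.

End outer_measure.
End completion.

(* Main.v *)
Require Import Defs.
From mathcomp Require Import all_boot all_order all_algebra.
From mathcomp Require Import all_classical all_reals all_analysis.
From mathcomp Require Import measurable_realfun.
From mathcomp Require Import ring lra.
Import Order.TTheory GRing.Theory Num.Theory.
Import numFieldNormedType.Exports.

Set Implicit Arguments.
Unset Strict Implicit.
Unset Printing Implicit Defensive.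

Local Open Scope classical_set_scope.
Local Open Scope ring_scope.

(** Why the theorem is true.

    The condition defining [UG eps u] is local.  A chain is a concatenation of
    steps, so the condition amounts to
      |u x - u y| <= (g x + g y) / 2 * d(x, y)   whenever d(x, y) <= eps.

    From chains to Lipschitz functions.  If u is L-Lipschitz, the slope of u at
    scale e, that is the supremum of |u y - u x| / d(x, y) over the points y
    with 0 < d(x, y) < e, controls u along every step shorter than e.  It is
    lower semicontinuous, bounded by L, and converges to lip u as e tends
    to 0, so dominated convergence carries the inequality from these slopes to
    lip u ([poincare_lip_of_UG]).

    From Lipschitz functions to chains.  The function u has to be approximated
    by Lipschitz functions w with lip w hardly larger than g.  Truncate u, so
    that |u| <= M.  For T large, u is T-Lipschitz on the set where g <= T; let
    U be a T-Lipschitz extension of this restriction, and let G be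
    max(g, 1/T) where g <= T and 2T elsewhere.  The step inequality survives
    for the couple (U, G), U is now Lipschitz, G lies between two positive
    constants, and, as T grows, G^p tends to g^p almost everywhere on the
    dilated ball below the bound (2g)^p + 1.
    The heart of the proof ([two_sided_approx]) is that U is a uniform limit of
    Lipschitz functions w with lip w <= (1 + e) G at every point.  They come
    from the weighted inf-convolution
      W x = inf_y (V y + G y * c(d(x, y)) * d(x, y)),
    where the weight c >= 1 grows like a logarithm.  A point y whose cost at x
    does not exceed V x satisfies G y * c(d(x, y)) <= G x, as V x - V y is at
    most max(G x, G y) d(x, y).  Because c grows so slowly, the cost of such a
    y has slope at most (1 + e) G x at x, and therefore W increases away from
    x with slope at most (1 + e) G x.  A second convolution, applied to -W,
    controls the slope in both directions.  Letting e tend to 0 and then T to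
    infinity proves the inequality for the truncations of u; their uniformly
    bounded oscillations force u to be integrable on the ball
    ([integrable_of_trunc]), and the truncation level can be sent to infinity.

    The completion.  Its measure is the pushforward of mu by the embedding i,
    so averages over a ball of Y are averages over the trace of this ball on X
    ([avg_completion]); by density lip v (i x) = lip (v o i) x
    ([lip_completion]), and Lipschitz functions extend from X to Y.  Balls
    centred in X thus carry the inequality from Y to X.  Conversely the trace
    of a ball of Y with any centre y is exhausted by balls of X whose centres
    tend to y and whose radii r - delta_k increase to r; since lambda >= 1
    their dilations stay in the dilated ball, and dominated convergence gives
    the inequality on Y with the same constants
    ([poincare_completion_extend]). *)

(** * A weight of logarithmic growth *)

Section slow_growth.
Context {R : realType}.
Implicit Types k s t D L h : R.

(** A weight with two competing properties: it is unbounded as s tends to 0,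
    so that distant points are too expensive, yet t * slow'(t) <= k, so that
    t * slow(t) has a slope close to slow(t). *)
Definition slow k s t := 1 + k * ln (1 + t / s).

Lemma slow_ge1 k s t : 0 <= k -> 0 < s -> 0 <= t -> 1 <= slow k s t.
Proof.
move=> k0 s0 t0; rewrite /slow lerDl mulr_ge0// ln_ge0// lerDl.
by rewrite divr_ge0// ltW.
Qed.

Lemma slow_gt1 k s t : 0 < k -> 0 < s -> 0 < t -> 1 < slow k s t.
Proof.
move=> k0 s0 t0; rewrite /slow ltrDl mulr_gt0// ln_gt0// ltrDl.
by rewrite divr_gt0.
Qed.

Lemma le_slow k s t t' : 0 <= k -> 0 < s -> 0 <= t -> t <= t' ->
  slow k s t <= slow k s t'.
Proof.
move=> k0 s0 t0 tt'; rewrite /slow lerD2l ler_wpM2l// ler_ln ?posrE; last first.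
- by rewrite ltr_pwDl ?ltr01// divr_ge0 ?(le_trans t0 tt')// ltW.
- by rewrite ltr_pwDl ?ltr01// divr_ge0// ltW.
by rewrite lerD2l ler_pM2r// invr_gt0.
Qed.

(** The quotient of the arguments of the two logarithms is exactly
    1 + D / (s + t). *)
Lemma slow_add_le k s t D : 0 <= k -> 0 < s -> 0 <= t -> 0 <= D ->
  slow k s (t + D) <= slow k s t + k * (D / (s + t)).
Proof.
move=> k0 s0 t0 D0; rewrite /slow -addrA lerD2l -mulrDr ler_wpM2l//.
have st0 : 0 < s + t by rewrite ltr_pwDl.
have -> : 1 + (t + D) / s = (1 + t / s) * (1 + D / (s + t)).
  by field; rewrite !gt_eqF.
have Dst : 0 <= D / (s + t) by rewrite divr_ge0// ltW.
rewrite lnM ?posrE; last 2 first.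
- by rewrite ltr_pwDl// divr_ge0// ltW.
- by rewrite ltr_pwDl.
by rewrite lerD2l le_ln1Dx// (lt_le_trans _ Dst)// ltrN10.
Qed.

(** The linear term carries the factor 1 + k and the remainder is quadratic in
    the increment D: this is how a cost moves with its base point. *)
Lemma slow_step k s t D : 0 <= k -> 0 < s -> 0 <= t -> 0 <= D ->
  slow k s (t + D) * (t + D) <=
  slow k s t * t + (1 + k) * slow k s t * D + k / s * D ^+ 2.
Proof.
move=> k0 s0 t0 D0; have st0 : 0 < s + t by rewrite ltr_pwDl.
have c1 := slow_ge1 k0 s0 t0.
have := slow_add_le k0 s0 t0 D0; move: c1; set c := slow k s t => c1.
have tD0 : 0 <= t + D by rewrite addr_ge0.
move=> /(ler_wpM2r tD0)/le_trans; apply.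
have fracE : D / (s + t) * (t + D) <= D + D ^+ 2 / s.
  rewrite mulrDr lerD//.
    by rewrite mulrAC ler_pdivrMr// ler_wpM2l// lerDr ltW.
  rewrite mulrAC -expr2 ler_wpM2l// ?exprn_ge0// lef_pV2 ?posrE//.
  by rewrite lerDl.
have : k * (D / (s + t) * (t + D)) <= k * (D + D ^+ 2 / s) by rewrite ler_wpM2l.
have : k * D * 1 <= k * D * c by rewrite ler_wpM2l// mulr_ge0.
have -> : k / s * D ^+ 2 = k * (D ^+ 2 / s) by rewrite mulrAC mulrA.
nra.
Qed.

Lemma slow_unbounded k h L : 0 < k -> 0 < h ->
  exists2 s, 0 < s & L < slow k s h.
Proof.
move=> k0 h0.
(* With s chosen so that 1 + h / s = exp N, the weight at h is 1 + k * N. *)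
pose N := Num.max 1 (L / k).
have N0 : 0 < N by rewrite /N lt_max ltr01.
have e1 : 0 < expR N - 1 by rewrite subr_gt0 pexpR_gt1.
exists (h / (expR N - 1)); first by rewrite divr_gt0.
rewrite /slow (_ : 1 + h / _ = expR N); last by field; rewrite !gt_eqF.
rewrite expRK.
rewrite ltr_pwDl// mulrC -ler_pdivrMr//.
by rewrite /N le_max lexx orbT.
Qed.

End slow_growth.

(** * Weighted inf-convolution *)

Section regularization.
Context {R : realType} {X : metricType R}.
Variables (V G : X -> R) (L a b eps k s h : R).
Hypothesis L0 : 0 <= L.
Hypothesis lipV : forall x y, `|V x - V y| <= L * mdist x y.
Hypothesis a0 : 0 < a.
Hypothesis aG : forall x, a <= G x.
Hypothesis Gb : forall x, G x <= b.
Hypothesis k0 : 0 < k.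
Hypothesis s0 : 0 < s.
Hypothesis h0 : 0 < h.
Hypothesis heps : h <= eps.
Hypothesis Lh : L < a * slow k s h.
Hypothesis VG : forall x y, mdist x y <= eps ->
  V x - V y <= Num.max (G x) (G y) * mdist x y.

Let cost x y := V y + G y * (slow k s (mdist x y) * mdist x y).

(** The factor G is evaluated at the competitor y, not at x: the slope of the
    cost at an optimal y is then comparable with G y, which optimality compares
    with G x. *)
Definition regularize x := inf [set cost x y | y in [set: X]].

Let G0 x : 0 < G x. Proof. exact: lt_le_trans (aG x). Qed.

(** The key inequality.  A competitor of cost at most V x is close to x, because
    the Lipschitz bound on V cannot pay for the weight beyond distance h.  The
    hypothesis on V and G then reads G y * slow <= max (G x) (G y), and the
    maximum cannot be G y as the weight exceeds 1 when y differs from x. *)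
Lemma cost_local x y : cost x y <= V x ->
  mdist x y < h /\ G y * slow k s (mdist x y) <= G x.
Proof.
have := mdist_ge0 x y; rewrite le_eqVlt => /predU1P[d0|d0].
  move: d0 => /esym/mdist_positivity <- _; rewrite mdistxx; split => //.
  by rewrite /slow mul0r addr0 ln1 mulr0 addr0 mulr1.
rewrite /cost -lerBrDl => Vyx.
have dh : mdist x y < h.
  rewrite ltNge; apply/negP => hd.
  have : G y * slow k s (mdist x y) * mdist x y <= L * mdist x y.
    by rewrite -mulrA (le_trans Vyx)// (le_trans (ler_norm _)).
  rewrite ler_pM2r// leNgt => /negP; apply; rewrite (lt_le_trans Lh)//.
  rewrite ler_pM ?aG// ?(ltW a0)//; first exact/(le_trans ler01)/slow_ge1/ltW/h0/s0/ltW/k0.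
  by rewrite le_slow// ltW.
split => //.
have := le_trans Vyx (VG (le_trans (ltW dh) heps)).
rewrite mulrA ler_pM2r// le_max => /orP[//|].
rewrite -{2}[G y]mulr1 ler_pM2l// leNgt => /negP[].
exact: slow_gt1.
Qed.

Lemma cost_ge x y : V x - L * h <= cost x y.
Proof.
have [/[dup] xy /cost_local[dh _]|/ltW Vxy] := leP (cost x y) (V x); last first.
  by rewrite (le_trans _ Vxy)// gerBl mulr_ge0// ltW.
rewrite /cost; have Gc : 0 <= G y * (slow k s (mdist x y) * mdist x y).
  rewrite mulr_ge0 ?(ltW (G0 y))// mulr_ge0 ?mdist_ge0//.
  by rewrite (le_trans ler01)// slow_ge1 ?mdist_ge0// ltW.
have := le_trans (ler_norm _) (lipV x y).
have : L * mdist x y <= L * h by rewrite ler_wpM2l// ltW.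
lra.
Qed.

Let lbW x : has_lbound [set cost x y | y in [set: X]].
Proof. by exists (V x - L * h) => _ [y _ <-]; exact: cost_ge. Qed.

Lemma regularize_le_cost x y : regularize x <= cost x y.
Proof. by apply: (ge_inf (lbW x)); exists y. Qed.

Let costxx x : cost x x = V x.
Proof. by rewrite /cost mdistxx !mulr0 addr0. Qed.

Lemma regularize_le x : regularize x <= V x.
Proof. by rewrite -[leRHS]costxx regularize_le_cost. Qed.

Lemma regularize_ge x : V x - L * h <= regularize x.
Proof.
apply: lb_le_inf; first by exists (cost x x), x.
by move=> _ [y _ <-]; exact: cost_ge.
Qed.

(** Almost optimal competitors can be chosen with cost at most V x, without
    any slack, so that [cost_local] applies to them: either x itself is
    optimal, or the infimum is strictly below V x. *)
Lemma regularize_near x e : 0 < e ->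
  exists2 y, cost x y <= V x & cost x y <= regularize x + e.
Proof.
move=> e0; have := regularize_le x; rewrite le_eqVlt => /predU1P[WV|WV].
  by exists x; rewrite costxx// WV lerDl ltW.
have m0 : 0 < Num.min e (V x - regularize x) by rewrite lt_min e0 subr_gt0.
have hi : has_inf [set cost x y | y in [set: X]].
  by split => //; exists (cost x x), x.
have [_ [y _ <-]] := inf_adherent m0 hi.
rewrite -/(regularize x) -ltrBlDl lt_min => /andP[y1 y2].
by exists y; rewrite ltW //; lra.
Qed.

Let cost_step x x' y : cost x y <= V x ->
  cost x' y <= cost x y +
    (1 + k) * (G y * slow k s (mdist x y)) * mdist x x'
      + b * (k / s) * mdist x x' ^+ 2.
Proof.
move=> xy; set D := mdist x x'; set d := mdist x y.
have d0 : 0 <= d by exact: mdist_ge0.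
have D0 : 0 <= D by exact: mdist_ge0.
have d'dD : mdist x' y <= d + D.
  by rewrite addrC /D (metric_sym x x') metric_triangle.
have := slow_step (ltW k0) s0 d0 D0.
have : slow k s (mdist x' y) * mdist x' y <= slow k s (d + D) * (d + D).
  rewrite ler_pM// ?mdist_ge0//.
    by rewrite (le_trans ler01)// slow_ge1 ?mdist_ge0// ltW.
  by rewrite le_slow ?mdist_ge0// ltW.
move=> /le_trans h1 /h1{h1} /(ler_wpM2l (ltW (G0 y))).
have : G y * (k / s * D ^+ 2) <= b * (k / s * D ^+ 2).
  by rewrite ler_wpM2r ?Gb// mulr_ge0 ?sqr_ge0// divr_ge0// ltW.
rewrite /cost -/d; lra.
Qed.

(** Testing the infimum at x' with an almost optimal competitor of x bounds
    the increase of the regularization from x by the slope of one cost. *)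
Lemma regularize_step x x' : regularize x' - regularize x <=
  (1 + k) * G x * mdist x x' + b * (k / s) * mdist x x' ^+ 2.
Proof.
apply/ler_addgt0Pr => e e0.
have [y yx yW] := regularize_near x e0.
have [_ Gyx] := cost_local yx.
have := cost_step x' yx; have := regularize_le_cost x' y.
have : (1 + k) * (G y * slow k s (mdist x y)) * mdist x x' <=
       (1 + k) * G x * mdist x x'.
  by rewrite ler_wpM2r ?mdist_ge0// ler_wpM2l// addr_ge0// ltW.
lra.
Qed.

(** Under the one-sided bound at x the decrease from x is controlled as well.
    Take an almost optimal competitor y of x'.  If its weighted slope is at
    most G x, move its cost from x' to x.  Otherwise its cost at x' is at
    least V y + G x * d(x', y), which dominates V x up to G x * d(x, x'). *)
Lemma regularize_back x x' :
  (forall y, mdist x y <= eps -> V x - V y <= G x * mdist x y) ->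
  h + mdist x x' <= eps ->
  regularize x - regularize x' <=
  (1 + k) * G x * mdist x x' + b * (k / s) * mdist x x' ^+ 2.
Proof.
move=> VGx hD; apply/ler_addgt0Pr => e e0.
have [y yx' yW] := regularize_near x' e0.
have [dh _] := cost_local yx'.
have D0 : 0 <= mdist x x' by exact: mdist_ge0.
have [Gyx|Gxy] := leP (G y * slow k s (mdist x' y)) (G x).
  have := cost_step x yx'; have := regularize_le_cost x y.
  have : (1 + k) * (G y * slow k s (mdist x' y)) * mdist x' x <=
       (1 + k) * G x * mdist x' x.
    by rewrite ler_wpM2r ?mdist_ge0// ler_wpM2l// addr_ge0// ltW.
  rewrite (metric_sym x' x); lra.
have dxy : mdist x y <= mdist x' y + mdist x x'.
  by rewrite addrC metric_triangle.
have /VGx : mdist x y <= eps.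
  by rewrite (le_trans dxy)// (le_trans _ hD)// lerD2r ltW.
have := regularize_le x.
have : G x * mdist x' y <= G y * slow k s (mdist x' y) * mdist x' y.
  by rewrite ler_wpM2r ?mdist_ge0// ltW.
have := ler_wpM2l (ltW (G0 x)) dxy.
have : 0 <= k * G x * mdist x x' by rewrite !mulr_ge0 ?(ltW (G0 x))// ltW.
have : 0 <= b * (k / s) * mdist x x' ^+ 2.
  rewrite mulr_ge0 ?sqr_ge0// mulr_ge0// ?divr_ge0 ?ltW//.
  exact: lt_le_trans (G0 x) (Gb x).
move: yW; rewrite /cost; lra.
Qed.

End regularization.

Section approximation.
Context {R : realType} {X : metricType R}.
Implicit Types (V G U : X -> R).

(** The quadratic remainder of [regularize_step] is absorbed at small scales
    by the lower bound a on G. *)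
Lemma one_sided_approx V G (L a b eps e : R) :
  0 <= L -> (forall x y, `|V x - V y| <= L * mdist x y) ->
  0 < a -> (forall x, a <= G x <= b) -> 0 < eps ->
  (forall x y, mdist x y <= eps ->
    V x - V y <= Num.max (G x) (G y) * mdist x y) ->
  0 < e ->
  exists2 W : X -> R,
    (exists2 L', 0 <= L' & forall x y, `|W x - W y| <= L' * mdist x y) /\
    (forall x, `|W x - V x| <= e) &
    exists2 e', 0 < e' & forall x x', mdist x x' <= e' ->
      W x' - W x <= (1 + e) * G x * mdist x x' /\
      ((forall y, mdist x y <= eps -> V x - V y <= G x * mdist x y) ->
       W x - W x' <= (1 + e) * G x * mdist x x').
Proof.
move=> L0 lipV a0 aGb eps0 VG e0.
have aG x : a <= G x by case/andP: (aGb x).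
have Gb x : G x <= b by case/andP: (aGb x).
have [x0|X0] := pselect (exists x : X, True); last first.
  exists V; last by exists 1 => // x; case: X0; exists x.
  split; first by exists L.
  by move=> x; case: X0; exists x.
have b0 : 0 < b by case: x0 => x _; rewrite (lt_le_trans a0)// (le_trans (aG x)).
(* h <= eps / 2 leaves room for steps of length eps / 2 in regularize_back, and
   L * h <= e makes the regularization e-close to V. *)
pose h := Num.min (eps / 2) (e / (L + 1)).
have L10 : 0 < L + 1 by rewrite ltr_wpDl.
have h0 : 0 < h by rewrite lt_min !divr_gt0.
have heps2 : h <= eps / 2 by rewrite ge_min lexx.
have heps : h <= eps by lra.
have Lhe : L * h <= e.
  have : h <= e / (L + 1) by rewrite ge_min lexx orbT.
  rewrite ler_pdivlMr// => /(le_trans _); apply.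
  by rewrite mulrC ler_wpM2l ?(ltW h0)// lerDl.
pose k := e / 2; have k0 : 0 < k by rewrite divr_gt0.
have [s s0 Ls] := slow_unbounded (L / a) k0 h0.
have Lh : L < a * slow k s h by rewrite mulrC -ltr_pdivrMr.
pose W := regularize V G k s.
(* Below the scale a * s / b the quadratic remainder b * (k / s) * D ^ 2 is at
   most k * a * D. *)
pose e' := Num.min (eps / 2) (a * s / b).
have e'0 : 0 < e' by rewrite lt_min !divr_gt0// mulr_gt0.
have WV x : W x <= V x <= W x + L * h.
  apply/andP; split; last first.
    by rewrite -lerBlDr (regularize_ge L0 lipV a0 aG k0 s0 h0 heps Lh VG).
  exact: (regularize_le L0 lipV a0 aG k0 s0 h0 heps Lh VG).
have small x (D : R) : 0 <= D -> D <= e' ->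
    (1 + k) * G x * D + b * (k / s) * D ^+ 2 <= (1 + e) * G x * D.
  move=> D0; rewrite le_min => /andP[_].
  rewrite ler_pdivlMr// => Das.
  have : b * (k / s) * D ^+ 2 <= k * G x * D.
    have -> : b * (k / s) * D ^+ 2 = k * D * (D * b / s).
      by rewrite expr2; field; rewrite gt_eqF.
    have -> : k * G x * D = k * D * G x by ring.
    have kD : 0 <= k * D by rewrite mulr_ge0// ltW.
    apply: ler_wpM2l kD _ _ _; apply: le_trans (aG x).
    by rewrite ler_pdivrMr.
  have -> : e = k + k by rewrite /k -splitr.
  lra.
have W1 x x' : mdist x x' <= e' -> W x' - W x <= (1 + e) * G x * mdist x x'.
  move=> dx; apply: le_trans (small _ _ (mdist_ge0 _ _) dx).
  exact: (regularize_step L0 lipV a0 aG Gb k0 s0 h0 heps Lh VG).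
exists W; last first.
  exists e' => // x x' dx; split; first exact: W1.
  move=> VGx; apply: le_trans (small _ _ (mdist_ge0 _ _) dx).
  apply: (regularize_back L0 lipV a0 aG Gb k0 s0 h0 heps Lh VG) => //.
  by move: dx; rewrite le_min => /andP[dx _]; lra.
split; last first.
  by move=> x; rewrite ler_norml; have := WV x => /andP[]; lra.
exists ((1 + e) * b + L + e / e').
  by rewrite !addr_ge0 ?mulr_ge0 ?addr_ge0 ?invr_ge0// ltW.
have one x y : W x - W y <= ((1 + e) * b + L + e / e') * mdist x y.
  have d0 : 0 <= mdist x y by exact: mdist_ge0.
  have t1 : 0 <= L * mdist x y by rewrite mulr_ge0.
  have t2 : 0 <= e / e' * mdist x y by rewrite mulr_ge0// divr_ge0// ltW.
  have t3 : 0 <= (1 + e) * b * mdist x y by rewrite !mulr_ge0 ?addr_ge0// ltW.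
  have [dxy|dxy] := leP (mdist x y) e'.
    have := W1 y x; rewrite metric_sym => /(_ dxy).
    have : (1 + e) * G y * mdist x y <= (1 + e) * b * mdist x y.
      by rewrite ler_wpM2r// ler_wpM2l// addr_ge0// ltW.
    lra.
  have : e <= e / e' * mdist x y.
    by rewrite -mulrA ler_peMr ?(ltW e0)// mulrC ler_pdivlMr// mul1r ltW.
  have := le_trans (ler_norm _) (lipV x y).
  have /andP[+ _] := WV x; have /andP[_] := WV y.
  lra.
move=> x y; rewrite ler_norml one andbT lerNl opprB.
by rewrite metric_sym one.
Qed.

(** Two convolutions: the first turns the symmetric hypothesis into a bound on
    the increase of the function; the second one, applied to its opposite,
    keeps this bound and adds the bound in the other direction. *)
Lemma two_sided_approx U G (L a b eps e : R) :
  0 <= L -> (forall x y, `|U x - U y| <= L * mdist x y) ->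
  0 < a -> (forall x, a <= G x <= b) -> 0 < eps ->
  (forall x y, mdist x y <= eps ->
    `|U x - U y| <= Num.max (G x) (G y) * mdist x y) ->
  0 < e ->
  exists2 w : X -> R,
    (exists2 L', 0 <= L' & forall x y, `|w x - w y| <= L' * mdist x y) /\
    (forall x, `|w x - U x| <= e) &
    exists2 e', 0 < e' & forall x x', mdist x x' <= e' ->
      `|w x' - w x| <= (1 + e) * G x * mdist x x'.
Proof.
move=> L0 lipU a0 aGb eps0 UG e0.
(* (1 + e1)^2 <= 1 + e, as e1 <= 1 and 3 * e1 <= e. *)
pose e1 := Num.min 1 (e / 3).
have e10 : 0 < e1 by rewrite lt_min ltr01 divr_gt0.
have e11 : e1 <= 1 by rewrite ge_min lexx.
have e1e : e1 <= e / 3 by rewrite ge_min lexx orbT.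
have UG' x y : mdist x y <= eps ->
    U x - U y <= Num.max (G x) (G y) * mdist x y.
  by move=> /UG; apply: le_trans; exact: ler_norm.
have [v [[L1 L10 lipv] vU] [eps1 eps10 v1]] :=
  one_sided_approx L0 lipU a0 aGb eps0 UG' e10.
pose V x := - v x; pose G1 x := (1 + e1) * G x.
have e1p : 0 < 1 + e1 by rewrite addr_gt0.
have lipV x y : `|V x - V y| <= L1 * mdist x y.
  by rewrite /V -opprB opprK addrC normrN lipv.
have aGb1 x : (1 + e1) * a <= G1 x <= (1 + e1) * b.
  by rewrite !ler_pM2l.
have V1 x y : mdist x y <= eps1 -> V x - V y <= G1 x * mdist x y.
  by move=> /v1[+ _]; rewrite /V /G1 opprK addrC.
have VG1 x y : mdist x y <= eps1 ->
    V x - V y <= Num.max (G1 x) (G1 y) * mdist x y.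
  move=> /V1/le_trans; apply.
  by rewrite ler_wpM2r ?mdist_ge0// le_max lexx.
have [W [[L2 L20 lipW] WV] [eps2 eps20 W2]] :=
  one_sided_approx L10 lipV (mulr_gt0 e1p a0) aGb1 eps10 VG1 e10.
exists (fun x => - W x).
  split; first by exists L2 => // x y; rewrite -opprB opprK addrC normrN lipW.
  move=> x; have -> : - W x - U x = - (W x - V x) + (v x - U x).
    by rewrite /V; ring.
  rewrite (le_trans (ler_normD _ _))// normrN.
  have := WV x; have := vU x; lra.
exists eps2 => // x x' dx.
have d0 : 0 <= mdist x x' by exact: mdist_ge0.
have [W21 /(_ (V1 x)) W22] := W2 _ _ dx.
have Gx0 : 0 <= G x by case/andP: (aGb x) => + _; apply/le_trans/ltW.
have bnd : (1 + e1) * G1 x * mdist x x' <= (1 + e) * G x * mdist x x'.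
  rewrite ler_wpM2r// /G1 mulrA ler_wpM2r//.
  have : e1 * e1 <= e1 * 1 by rewrite ler_wpM2l// ltW.
  lra.
rewrite -opprB opprK addrC ler_norml; lra.
Qed.

End approximation.

(** * Slopes and upper gradients along chains *)

Section slope.
Context {R : realType} {X : pmetricType R}.
Implicit Types (u : X -> R) (g : X -> \bar R).
Local Open Scope ereal_scope.

Definition slope u (x : X) (e : R) : \bar R :=
  ereal_sup [set (`|u y - u x| / mdist x y)%:E | y in ball x e `\ x].

Lemma open_ballP (U : set X) :
  (forall x, U x -> exists2 e : R, (0 < e)%R & ball x e `<=` U) -> open U.
Proof.
move=> h; rewrite openE => x /h[e e0 eU].
by rewrite /interior; apply/nbhs_ballP; exists e.
Qed.

Lemma open_metric_ball (x : X) (r : R) : open (ball x r).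
Proof.
apply: open_ballP => y; rewrite ballEmdist/= => xy.
exists (r - mdist x y)%R; first by rewrite subr_gt0.
move=> z; rewrite !ballEmdist/= => yz.
by rewrite (le_lt_trans (metric_triangle x y z))// -ltrBrDl.
Qed.

Lemma isolated_ball (x : X) : isolated [set: X] x ->
  exists2 e : R, (0 < e)%R & ball x e `\ x = set0.
Proof.
move=> [_ [V /nbhs_ballP[e e0 eV] VE]]; exists e => //.
apply/seteqP; split => // y [/eV Vy yx]; apply: yx.
by rewrite -VE; split.
Qed.

Lemma not_isolated_ball (x : X) (e : R) : ~ isolated [set: X] x ->
  (0 < e)%R -> exists2 y, ball x e y & y <> x.
Proof.
move=> nix e0; apply: contrapT => h; apply: nix; split; first by rewrite inE.
exists (ball x e); first exact: nbhsx_ballx.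
apply/seteqP; split => [y [xy _]/=|_ ->].
  by apply: contrapT => yx; apply: h; exists y.
by split => //; exact: ballxx.
Qed.

Lemma le_slope u x (e e' : R) : (e <= e')%R -> slope u x e <= slope u x e'.
Proof.
move=> ee'; apply: ereal_sup_le => _ [y [xy yx] <-]; exists y => //; split => //.
exact: le_ball xy.
Qed.

Lemma slope_ge u x (e : R) y : ball x e y -> y <> x ->
  (`|u y - u x| / mdist x y)%:E <= slope u x e.
Proof. by move=> xy yx; apply: ereal_sup_ubound; exists y. Qed.

Lemma slope_ge0 u x (e : R) : ~ isolated [set: X] x -> (0 < e)%R ->
  0 <= slope u x e.
Proof.
move=> nix e0; have [y xy yx] := not_isolated_ball nix e0.
apply: (le_trans _ (slope_ge u xy yx)).
by rewrite lee_fin divr_ge0// mdist_ge0.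
Qed.

Lemma slope_le u x (e a : R) :
  (forall y, ball x e y -> `|u y - u x| <= a * mdist x y)%R ->
  slope u x e <= a%:E.
Proof.
move=> h; apply: ge_ereal_sup => _ [y [xy yx] <-]; rewrite lee_fin.
rewrite ler_pdivrMr ?h// mdist_gt0; apply/eqP => xy'; exact: yx.
Qed.

Lemma cvg_slope u x : ~ isolated [set: X] x ->
  slope u x e @[e --> (0 : R)^'+] --> lip u x.
Proof.
move=> nix; rewrite /lip; case: asboolP => // _.
have : cvg (slope u x e @[e --> (0 : R)^'+]).
  apply: nondecreasing_at_right_is_cvge; near=> z => a b _ _.
  exact: le_slope.
by [].
Unshelve. all: by end_near. Qed.

Lemma lip_isolated u x : isolated [set: X] x -> lip u x = 0.
Proof. by move=> ix; rewrite /lip; case: asboolP. Qed.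

Lemma lip_ge0 u x : 0 <= lip u x.
Proof.
have [ix|nix] := pselect (isolated [set: X] x); first by rewrite lip_isolated.
have <- := cvg_lim (@ereal_hausdorff R) (@cvg_slope u x nix).
apply: lime_ge; first by apply/cvg_ex; eexists; exact: cvg_slope.
near=> e; apply: slope_ge0 => //.
Unshelve. all: by end_near. Qed.

Lemma lip_le u x (e a : R) : (0 <= a)%R -> (0 < e)%R ->
  (forall y, ball x e y -> `|u y - u x| <= a * mdist x y)%R ->
  lip u x <= a%:E.
Proof.
move=> a0 e0 h.
have [ix|nix] := pselect (isolated [set: X] x).
  by rewrite lip_isolated.
have <- := cvg_lim (@ereal_hausdorff R) (@cvg_slope u x nix).
apply: lime_le; first by apply/cvg_ex; eexists; exact: cvg_slope.
near=> e'; apply: slope_le => y xy; apply: h; apply: le_ball xy.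
by near: e'; exact: nbhs_right_le.
Unshelve. all: by end_near. Qed.

(** The maximum with 0 only matters when the punctured ball is empty, where
    the supremum is -oo. *)
Definition scale_slope u (e : R) (x : X) : \bar R := maxe 0 (slope u x e).

Lemma scale_slope_ge0 u e x : 0 <= scale_slope u e x.
Proof. by rewrite le_max lexx. Qed.

Lemma scale_slope_le u (a e : R) x : (0 <= a)%R ->
  (forall x y, `|u x - u y| <= a * mdist x y)%R -> scale_slope u e x <= a%:E.
Proof.
move=> a0 lipu; rewrite ge_max lee_fin a0/=; apply: slope_le => y _.
by rewrite metric_sym.
Qed.

Lemma cvg_invn_at_right : (n.+1%:R^-1 : R)%R @[n --> \oo] --> (0%R : R)^'+.
Proof.
move=> A /nbhs_ballP[e /= e0 eA].
have : \forall n \near \oo, (n.+1%:R^-1 < e :> R)%R.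
  by have /cvgrPdist_lt/(_ _ e0) := @cvg_harmonic R;
    apply: filterS => n /=; rewrite sub0r normrN ger0_norm.
apply: filterS => n ne; apply: eA => //=.
by rewrite /ball/= sub0r normrN ger0_norm// invr_ge0.
Qed.

Lemma cvg_scale_slope u x :
  scale_slope u n.+1%:R^-1 x @[n --> \oo] --> lip u x.
Proof.
have [ix|nix] := pselect (isolated [set: X] x).
  rewrite lip_isolated//; have [e e0 xe] := isolated_ball ix.
  apply: cvg_near_cst; near=> n; rewrite /scale_slope.
  suff -> : slope u x n.+1%:R^-1 = -oo by rewrite maxeNy.
  rewrite /slope [X in image X](_ : _ = set0) ?image_set0 ?ereal_sup0//.
  apply/seteqP; split => // y [xy yx]; rewrite -[set0 y]/(set0 y) -xe; split => //.
  apply: le_ball xy; apply: ltW; near: n.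
  have /cvgrPdist_lt/(_ _ e0) := @cvg_harmonic R.
  by apply: filterS => n /=; rewrite sub0r normrN ger0_norm.
have -> : (fun n => scale_slope u n.+1%:R^-1 x) = (fun n => slope u x n.+1%:R^-1).
  by apply/funext => n; rewrite /scale_slope; apply/max_idPr; exact: slope_ge0.
exact: (cvg_comp _ _ cvg_invn_at_right (@cvg_slope u x nix)).
Unshelve. all: by end_near. Qed.

Lemma lsc_borel (f : X -> \bar R) :
  (forall r : R, open [set x | r%:E < f x]) -> borel_fun f.
Proof.
move=> fo; apply: (measurability _ (ErealGenOInfty.measurableE R)).
move=> /= _ [_ [a ->]] <-; rewrite setTI preimage_itvoy.
by apply: sub_sigma_algebra; exact: fo.
Qed.

(** The slope at a fixed scale is lower semicontinuous: a difference quotient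
    exceeding r at x still does so at the points near x, with the same y. *)
Lemma scale_slope_borel u (e L : R) : (0 <= L)%R ->
  (forall x y, `|u x - u y| <= L * mdist x y)%R ->
  borel_fun (scale_slope u e).
Proof.
move=> L0 lipu; apply: lsc_borel => r; apply: open_ballP => x /=.
rewrite lt_max => /orP[r0|].
  by exists 1%R => // z _ /=; rewrite lt_max r0.
have [r0 _|r0] := ltP r 0%R.
  by exists 1%R => // z _ /=; rewrite lt_max lte_fin r0.
move=> /ereal_sup_gt[_ [y [xy yx] <-]]; rewrite lte_fin.
have d0 : (0 < mdist x y)%R by rewrite mdist_gt0; apply/eqP => /esym.
rewrite ltr_pdivlMr// => gap; move: (xy); rewrite ballEmdist/= => xye.
(* A radius that keeps y distinct from z and in the ball around z, and the
   quotient above r. *)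
pose m := Num.min (mdist x y) (Num.min (e - mdist x y)
  ((`|u y - u x| - r * mdist x y) / (L + r + 1)))%R.
have Lr : (0 < L + r + 1)%R by rewrite ltr_wpDl// addr_ge0.
have m0 : (0 < m)%R by rewrite !lt_min d0 subr_gt0 xye divr_gt0// subr_gt0.
exists m => // z; rewrite ballEmdist/= !lt_min => /and3P[zd ze].
rewrite ltr_pdivlMr// => zgap.
have zx0 : (0 <= mdist x z)%R by exact: mdist_ge0.
have zy : (mdist z y <= mdist x z + mdist x y)%R.
  by rewrite (metric_sym x z) metric_triangle.
rewrite lt_max; apply/orP; right.
apply: (lt_le_trans _ (slope_ge u (_ : ball z e y) _)); last 2 first.
- by rewrite ballEmdist/=; lra.
- by move=> yz; rewrite yz ltxx in zd.
have zy0 : (0 < mdist z y)%R.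
  by rewrite mdist_gt0; apply/eqP => yz; rewrite -yz ltxx in zd.
rewrite lte_fin ltr_pdivlMr//.
have : (r * mdist z y <= r * (mdist x z + mdist x y))%R by rewrite ler_wpM2l.
have := lipu z x; rewrite (metric_sym z x).
have := ler_distD (u z) (u y) (u x).
by lra.
Qed.

Lemma lipschitz_funP u : lipschitz_fun u ->
  exists2 L : R, (0 <= L)%R & forall x y, (`|u x - u y| <= L * mdist x y)%R.
Proof.
move=> [L lipu]; exists (Num.max 0%R L); first by rewrite le_max lexx.
move=> x y; apply: le_trans (lipu x y) _.
by rewrite ler_wpM2r ?mdist_ge0// le_max lexx orbT.
Qed.

Lemma lipschitz_open_gt u (r : R) : lipschitz_fun u ->
  open [set x | (r < u x)%R].
Proof.
move=> /lipschitz_funP[L L0 lipu]; apply: open_ballP => x /= rux.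
have L1 : (0 < L + 1)%R by rewrite ltr_wpDl.
have xr : (0 < u x - r)%R by rewrite subr_gt0.
exists ((u x - r) / (L + 1))%R; first exact: divr_gt0.
move=> z; rewrite ballEmdist/= ltr_pdivlMr// => xz.
have := le_trans (ler_norm _) (lipu x z); have := mdist_ge0 x z.
by lra.
Qed.

Lemma lipschitz_borel u : lipschitz_fun u -> borel_fun u.
Proof.
move=> lipu; apply/measurable_EFinP; apply: lsc_borel => r.
exact: lipschitz_open_gt.
Qed.

Lemma lip_borel u : lipschitz_fun u -> borel_fun (lip u).
Proof.
move=> /lipschitz_funP[L L0 lipu].
apply: (@emeasurable_fun_cvg _ (g_sigma_algebraType (@open X)) R setT
  (fun n => scale_slope u n.+1%:R^-1) (lip u)).
  by move=> n; exact: scale_slope_borel lipu.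
by move=> x _; exact: cvg_scale_slope.
Qed.

Lemma UG_step (eps : R) u g x y : UG eps u g -> (mdist x y <= eps)%R ->
  `|u x - u y|%:E <= (g x + g y) / 2%:E * (mdist x y)%:E.
Proof.
move=> [_ _ /(_ 1%N (fun i => if i is 0%N then y else x))] ug xy.
have : is_chain eps 1 (fun i => if i is 0%N then y else x).
  by case=> [|[]]//= _; rewrite metric_sym.
move=> /ug; rewrite /chain_integral big_ord_recl big_ord0 adde0/=.
by rewrite addeC (metric_sym y x).
Qed.

(** On a step shorter than e the increment of u is bounded by the slope at
    either end, hence by the mean of the two. *)
Lemma scale_slope_UG u (e e' L : R) : (e' < e)%R -> (0 <= L)%R ->
  (forall x y, `|u x - u y| <= L * mdist x y)%R ->
  UG e' u (scale_slope u e).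
Proof.
move=> e'e L0 lipu; split.
- exact: scale_slope_borel lipu.
- by move=> x; exact: scale_slope_ge0.
have step x y : (mdist x y <= e')%R ->
    `|u y - u x|%:E <= scale_slope u e x * (mdist x y)%:E.
  move=> xy; have [->|xDy] := eqVneq x y.
    by rewrite subrr normr0 mdistxx mule0.
  have d0 : (0 < mdist x y)%R by rewrite mdist_gt0.
  have xye : ball x e y by rewrite ballEmdist/= (le_lt_trans xy).
  have : (`|u y - u x| / mdist x y)%:E <= scale_slope u e x.
    by rewrite le_max (slope_ge u) ?orbT//; apply/eqP; rewrite eq_sym.
  move=> /(lee_wpmul2r (ltW (_ : 0 < (mdist x y)%:E))); rewrite lte_fin => /(_ d0).
  by apply: le_trans; rewrite -EFinM divfK ?gt_eqF.
move=> N q; elim: N => [_|N IH qN].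
  by rewrite /chain_integral big_ord0 subrr normr0.
have : `|u (q N.+1) - u (q 0%N)|%:E <=
    `|u (q N.+1) - u (q N)|%:E + `|u (q N) - u (q 0%N)|%:E.
  by rewrite -EFinD lee_fin ler_distD.
move=> /le_trans; apply; rewrite /chain_integral big_ord_recr/= addeC leeD//.
  by apply: IH => i iN; apply: qN; rewrite ltnS ltnW.
have qe : (mdist (q N) (q N.+1) <= e')%R by exact: qN.
have h1 := step _ _ qe.
have h2 : `|u (q N.+1) - u (q N)|%:E <=
    scale_slope u e (q N.+1) * (mdist (q N) (q N.+1))%:E.
  by rewrite distrC metric_sym; apply: step; rewrite metric_sym.
have := scale_slope_le e (q N) L0 lipu; have := scale_slope_le e (q N.+1) L0 lipu.
move: h1 h2; have := scale_slope_ge0 u e (q N).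
have := scale_slope_ge0 u e (q N.+1).
case: (scale_slope u e (q N.+1)) => [r'| |]//; case: (scale_slope u e (q N)) => [r| |]//.
rewrite inver pnatr_eq0/= -!EFinM !lee_fin => *.
lra.
Qed.

End slope.

(** * Limits of powers *)

Section power_limits.
Context {R : realType}.

Lemma cvg_powR (u : R ^nat) (a q : R) : 0 < q -> (forall n, 0 <= u n) ->
  u n @[n --> \oo] --> a -> u n `^ q @[n --> \oo] --> a `^ q.
Proof.
move=> q0 u0 ua.
have : 0 <= a.
  by have <- := cvg_lim (@Rhausdorff R) ua; apply: limr_ge; [exact: cvgP ua|exact: nearW].
rewrite le_eqVlt => /predU1P[a0|a0]; last first.
  have cont : expR (q * ln x) @[x --> a] --> expR (q * ln a).
    apply: continuous_comp; last exact: continuous_expR.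
    by apply: cvgM; [exact: cvg_cst|exact: continuous_ln].
  have -> : a `^ q = expR (q * ln a) by rewrite /powR gt_eqF.
  apply: cvg_trans (cvg_comp _ _ ua cont).
  apply: near_eq_cvg; near=> n; rewrite /powR gt_eqF//.
  by near: n; exact: (cvgr_gt a).
rewrite -a0 powR0 ?gt_eqF//; apply/cvgrPdist_lt => e e0.
have e'0 : 0 < e `^ q^-1 by rewrite powR_gt0.
move/cvgrPdist_lt : ua => /(_ _ e'0); apply: filterS => n.
rewrite -a0 !sub0r !normrN !ger0_norm ?powR_ge0// => une.
have := gt0_ltr_powR q0 (u0 n) (powR_ge0 e q^-1) une.
by rewrite -powRrM mulVf ?gt_eqF// powRr1// ltW.
Unshelve. all: by end_near. Qed.

Local Open Scope ereal_scope.

Lemma le_poweR (p : R) (a b : \bar R) : (0 <= p)%R -> 0 <= a -> a <= b ->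
  a `^ p <= b `^ p.
Proof.
move=> p0 a0 ab; rewrite gt0_ler_poweR// in_itv/= leey andbT//.
exact: le_trans ab.
Qed.

Lemma cvg_poweR (u : (\bar R)^nat) (a : \bar R) (q : R) : (0 < q)%R ->
  (forall n, 0 <= u n) -> a \is a fin_num ->
  u n @[n --> \oo] --> a -> u n `^ q @[n --> \oo] --> a `^ q.
Proof.
move=> q0 u0; case: a => [a| |]// _ /fine_cvgP[ufin ua].
rewrite poweR_EFin; apply/fine_cvgP; split.
  by apply: filterS ufin => n; exact: fin_num_poweR.
have -> : fine \o (fun n => u n `^ q) = (fun n => (fine (u n)) `^ q)%R.
  by apply/funext => n /=; rewrite fine_poweR.
by apply: cvg_powR => // n; rewrite fine_ge0.
Qed.

(** The limit b may be 0, hence the continuity of powers up to the origin. *)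
Lemma le_poweR_limit (x y : (\bar R)^nat) (a b : \bar R) (K q : R) :
  (0 <= K)%R -> (0 < q)%R -> (forall n, 0 <= y n) -> b \is a fin_num ->
  x n @[n --> \oo] --> a -> y n @[n --> \oo] --> b ->
  (\forall n \near \oo, x n <= K%:E * y n `^ q) -> a <= K%:E * b `^ q.
Proof.
move=> K0 q0 y0 bfin xa yb xy.
have Ky : K%:E * y n `^ q @[n --> \oo] --> K%:E * b `^ q.
  by apply: cvgeZl => //; exact: cvg_poweR.
have <- := cvg_lim (@ereal_hausdorff R) xa.
have <- := cvg_lim (@ereal_hausdorff R) Ky.
by apply: lee_lim => //; [exact: cvgP xa|exact: cvgP Ky].
Qed.

End power_limits.

(** * Truncations *)

Section truncation.
Context {R : realType} {T : Type}.
Implicit Types (M : R) (u : T -> R).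

Definition trunc (M : R) (u : T -> R) (x : T) : R :=
  Num.max (- M) (Num.min M (u x)).

Lemma trunc_id (M : R) u x : (`|u x| <= M) -> trunc M u x = u x.
Proof.
by rewrite ler_norml /trunc => /andP[Mu uM]; rewrite (min_idPr uM) (max_idPr Mu).
Qed.

Lemma le_norm_trunc (M : R) u x : (0 <= M) -> (`|trunc M u x| <= M).
Proof.
move=> M0; rewrite /trunc ler_norml le_max lexx/= ge_max ge_min lexx/= andbT.
by rewrite (le_trans _ M0)// oppr_le0.
Qed.

Lemma le_trunc_norm (M : R) u x : (0 <= M) -> (`|trunc M u x| <= `|u x|).
Proof.
move=> M0; have [uM|uM] := leP `|u x| M; first by rewrite trunc_id.
by rewrite (le_trans (le_norm_trunc _ _ M0))// ltW.
Qed.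

Lemma trunc_contract (M : R) u x y :
  (`|trunc M u x - trunc M u y| <= `|u x - u y|).
Proof.
have := ler_norm (u x - u y); have := ler_norm (u y - u x).
rewrite (distrC (u y)) ler_norml /trunc.
by case: (leP M (u x)); case: (leP M (u y)); case: (leP (- M) M);
  case: (leP (- M) (u x)); case: (leP (- M) (u y)) => *; lra.
Qed.

Lemma norm_trunc (M : R) (v : T -> R) x : (0 <= M) ->
  (`|trunc M v x| = Num.min M `|v x|).
Proof.
move=> M0; have [uM|uM] := leP `|v x| M; first by rewrite trunc_id.
rewrite /trunc; move: uM; rewrite ltr_normr => /orP[Mu|Mu].
  by rewrite (min_idPl (ltW Mu)) max_r ?ger0_norm//; lra.
by rewrite min_r ?max_l ?normrN ?ger0_norm//; lra.
Qed.

Lemma cvg_trunc u x : trunc n%:R u x @[n --> \oo] --> u x.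
Proof.
apply: cvg_near_cst; near=> n; apply: trunc_id; near: n.
exact: nbhs_infty_ger.
Unshelve. all: by end_near. Qed.

End truncation.

(** * Averages and mean oscillations *)

Section averages.
Context d (T : measurableType d) (R : realType).
Variable m : {measure set T -> \bar R}.
Local Open Scope ereal_scope.
Implicit Types (A B : set T) (f : T -> \bar R) (u : T -> R).

(** On the Caratheodory measure of an outer measure this is [average]; the
    limit theorems below hold on any measure space. *)
Definition avg A f : \bar R := (m A)^-1 * \int[m]_(x in A) f x.

Definition oscillation A u : \bar R :=
  avg A (fun y => `|(u y)%:E - avg A (EFin \o u)|).

Lemma avg_ge0 A f : (forall x, A x -> 0 <= f x) -> 0 <= avg A f.
Proof. by move=> f0; rewrite mule_ge0 ?inve_ge0// integral_ge0. Qed.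

Lemma avg_null A f : measurable A -> measurable_fun A f -> m A = 0 ->
  avg A f = 0.
Proof. by move=> mA mf A0; rewrite /avg null_set_integral ?mule0. Qed.

Lemma le_avg A f g : measurable A -> measurable_fun A f ->
  measurable_fun A g -> (forall x, A x -> 0 <= f x) ->
  (forall x, A x -> f x <= g x) -> avg A f <= avg A g.
Proof.
move=> mA mf mg f0 fg; rewrite lee_pmul ?inve_ge0 ?integral_ge0//.
exact: ge0_le_integral.
Qed.

Lemma near_dominated_cvg A (f_ : (T -> \bar R)^nat) f F :
  measurable A -> (forall n, measurable_fun A (f_ n)) -> measurable_fun A f ->
  {ae m, forall x, A x -> f_ ^~ x @ \oo --> f x} -> m.-integrable A F ->
  (\forall n \near \oo, forall x, A x -> `|f_ n x| <= F x) ->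
  m.-integrable A f /\
  \int[m]_(x in A) f_ n x @[n --> \oo] --> \int[m]_(x in A) f x.
Proof.
move=> mA mf_ mf ff iF [N _ NF].
have [] := @dominated_convergence _ _ R m A mA (fun n => f_ (n + N)%N) f F.
- by move=> n; exact: mf_.
- exact: mf.
- by apply: filterS ff => x h /h; rewrite -(cvg_shiftn N).
- exact: iF.
- by apply: aeW => x n Ax; apply: NF => //=; exact: leq_addl.
by move=> intf _ h; split => //; rewrite -(cvg_shiftn N).
Qed.

Section exhaustion.
Variables (A_ : (set T)^nat) (A : set T).
Hypothesis mA_ : forall n, measurable (A_ n).
Hypothesis mA : measurable A.
Hypothesis subA : forall n, A_ n `<=` A.
Hypothesis exhA : forall x, A x -> \forall n \near \oo, A_ n x.
Hypothesis Afin : m A < +oo.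
Hypothesis A0 : 0 < m A.

(** Integrals over the sets A_ n are integrals over A of functions cut off by
    indicators, and these indicators tend to 1 pointwise on A. *)
Lemma cvg_integral_exhaustion (f_ : (T -> \bar R)^nat) f F :
  (forall n, measurable_fun A (f_ n)) -> measurable_fun A f ->
  {ae m, forall x, A x -> f_ ^~ x @ \oo --> f x} -> m.-integrable A F ->
  (\forall n \near \oo, forall x, A x -> `|f_ n x| <= F x) ->
  m.-integrable A f /\
  \int[m]_(x in A_ n) f_ n x @[n --> \oo] --> \int[m]_(x in A) f x.
Proof.
move=> mf_ mf ff iF fF.
have -> : (fun n => \int[m]_(x in A_ n) f_ n x) =
          (fun n => \int[m]_(x in A) (f_ n \_ (A_ n)) x).
  apply/funext => n; rewrite -integral_mkcondr.
  by have /setIidPr -> := @subA n.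
apply: near_dominated_cvg iF _ => //.
- move=> n; apply/measurable_restrict => //.
  by apply: measurable_funS (mf_ n) => //; exact: subIsetl.
- apply: filterS ff => x fx Ax; apply: cvg_trans (fx Ax).
  apply: near_eq_cvg; apply: filterS (exhA Ax) => n Anx.
  by rewrite patchE mem_set.
- apply: filterS fF => n fF x Ax; apply: le_trans (fF x Ax).
  by rewrite patchE; case: ifPn => //; rewrite abse0.
Qed.

Lemma cvg_measure_exhaustion : m (A_ n) @[n --> \oo] --> m A.
Proof.
have E B : measurable B -> m B = \int[m]_(x in B) cst 1 x.
  by move=> mB; rewrite integral_cst// mul1e.
have -> : (fun n => m (A_ n)) = (fun n => \int[m]_(x in A_ n) cst 1 x).
  by apply/funext => n; exact: E.
rewrite E//.
have [] // := @cvg_integral_exhaustion (fun=> cst 1) (cst 1) (cst 1).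
- by apply: aeW => x _; exact: cvg_cst.
- apply/integrableP; split; first exact: measurable_cst.
  under eq_integral do rewrite /= normr1.
  by rewrite -[X in X < _]/(\int[m]_(x in A) cst 1 x) -E.
- by apply: nearW => n x _; rewrite /= normr1.
Qed.

Lemma cvg_avg (f_ : (T -> \bar R)^nat) f F :
  (forall n, measurable_fun A (f_ n)) -> measurable_fun A f ->
  {ae m, forall x, A x -> f_ ^~ x @ \oo --> f x} -> m.-integrable A F ->
  (\forall n \near \oo, forall x, A x -> `|f_ n x| <= F x) ->
  avg A f \is a fin_num /\ avg (A_ n) (f_ n) @[n --> \oo] --> avg A f.
Proof.
move=> mf_ mf ff iF fF.
have [intf cf] := cvg_integral_exhaustion mf_ mf ff iF fF.
have finf : \int[m]_(x in A) f x \is a fin_num by exact: integrable_fin_num.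
have mAE : m A = (fine (m A))%:E by rewrite fineK// ge0_fin_numE.
have mA0 : fine (m A) != 0%R by rewrite gt_eqF// fine_gt0// A0.
have invfin : (m A)^-1 \is a fin_num by rewrite mAE inver (negbTE mA0).
split; first by rewrite fin_numM.
apply: cvgeM => //; first exact: mule_def_fin.
have := cvg_measure_exhaustion; rewrite {1}mAE => /fine_cvgP[mfin mcvg].
rewrite mAE inver (negbTE mA0).
have cV : (fine (m (A_ n)))^-1%:E @[n --> \oo] --> (fine (m A))^-1%:E.
  by apply: cvg_EFin; [exact: nearW|exact: cvgV].
apply: cvg_trans cV; apply: near_eq_cvg; near=> n.
have mfinn : m (A_ n) \is a fin_num by near: n; exact: mfin.
rewrite -{2}[m (A_ n)]fineK// inver ifF//; apply/negbTE.
by near: n; exact: (cvgr_neq0 _ mcvg).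
Unshelve. all: by end_near. Qed.

(** The averages converge first; being eventually bounded by a constant, they
    do not spoil the domination of the integrands of the oscillations. *)
Lemma cvg_oscillation (u_ : (T -> R)^nat) u F :
  (forall n, measurable_fun A (u_ n)) -> measurable_fun A u ->
  {ae m, forall x, A x -> (u_ n x)%R @[n --> \oo] --> u x} ->
  m.-integrable A F ->
  (\forall n \near \oo, forall x, A x -> `|u_ n x|%:E <= F x) ->
  oscillation (A_ n) (u_ n) @[n --> \oo] --> oscillation A u.
Proof.
move=> mu_ mu uu iF uF.
have [||||cfin cc] := @cvg_avg (fun n => EFin \o u_ n) (EFin \o u) F _ _ _ iF.
- by move=> n; exact/measurable_EFinP.
- exact/measurable_EFinP.
- by apply: filterS uu => x ux Ax; apply: cvg_EFin; [exact: nearW|exact: ux].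
- by apply: filterS uF => n uF x Ax /=; exact: uF.
rewrite /oscillation; set c := avg A (EFin \o u) in cfin cc *.
set c_ := fun n => avg (A_ n) (EFin \o u_ n) in cc.
have c_bnd : \forall n \near \oo, `|c_ n| <= `|c| + 1.
  have cE : `|c| = (fine `|c|)%:E by rewrite fineK ?abse_fin_num.
  have /fine_cvgP[ffin ac] : `|c_ n| @[n --> \oo] --> (fine `|c|)%:E.
    by rewrite -cE; exact: cvg_abse.
  have a1 : (fine `|c| < fine `|c| + 1)%R by rewrite ltrDl.
  near=> n; rewrite cE -EFinD -(@fineK _ `|c_ n|); last by near: n; exact: ffin.
  by rewrite lee_fin; near: n; exact: cvgr_le ac _ a1.
have [] // := @cvg_avg (fun n y => `|(u_ n y)%:E - c_ n|)
  (fun y => `|(u y)%:E - c|) (F \+ cst (`|c| + 1)).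
- move=> n; apply: measurableT_comp => //; apply: emeasurable_funB => //.
  exact/measurable_EFinP.
- apply: measurableT_comp => //; apply: emeasurable_funB => //.
  exact/measurable_EFinP.
- apply: filterS uu => x ux Ax; apply: cvg_abse; apply: cvgeB => //.
  by apply: cvg_EFin; [exact: nearW|exact: ux].
- apply: integrableD => //; apply/integrableP; split => //.
  under eq_integral do rewrite /=.
  rewrite -[X in X < _]/(\int[m]_(x in A) cst (`| `|c| + 1|) x) integral_cst//.
  by rewrite lte_mul_pinfty// abse_fin_num fin_numD abse_fin_num cfin.
apply: filterS2 uF c_bnd => n uFn cn x Ax; rewrite abse_id.
by apply: le_trans (lee_abs_sub _ _) _; rewrite leeD// uFn.
Unshelve. all: by end_near. Qed.

End exhaustion.

Lemma measurable_trunc A (M : R) u : measurable_fun A u ->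
  measurable_fun A (trunc M u).
Proof.
by move=> mu; apply: measurable_maxr => //; exact: measurable_minr.
Qed.

End averages.

(** * Integrability from bounded oscillations *)

Section integrability.
Context d (T : measurableType d) (R : realType).
Variable m : {measure set T -> \bar R}.
Local Open Scope ereal_scope.
Variables (A : set T) (u : T -> R).
Hypothesis mA : measurable A.
Hypothesis Afin : m A < +oo.
Hypothesis A0 : 0 < m A.
Hypothesis mu : measurable_fun A u.

Lemma integrable_bounded (v : T -> R) (M : R) : measurable_fun A v ->
  (forall x, A x -> `|v x| <= M)%R -> m.-integrable A (EFin \o v).
Proof.
move=> mv vM; apply/integrableP; split; first exact/measurable_EFinP.
apply: (@le_lt_trans _ _ (\int[m]_(x in A) cst M%:E x)).
  apply: ge0_le_integral => //.
  by apply: measurableT_comp => //; exact/measurable_EFinP.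
rewrite integral_cst//; have : 0 <= m A by exact: measure_ge0.
by case: (m A) Afin => // r _ _; rewrite -EFinM ltry.
Qed.

Lemma avg_fin_num f : m.-integrable A f -> avg m A f \is a fin_num.
Proof.
move=> /integrable_fin_num intf; rewrite /avg fin_numM ?intf//.
have mAE : m A = (fine (m A))%:E by rewrite fineK// ge0_fin_numE.
by rewrite mAE inver gt_eqF// fine_gt0// A0.
Qed.

(** Some set S where |u| <= N has positive measure.  There the truncations of
    u at levels n >= N agree with u, hence are at most N in absolute value, and
    the bound on the oscillation over S bounds their means c_n, hence their
    integrals, uniformly in n.  Monotone
    convergence concludes. *)
Lemma integrable_of_trunc (K : R) : (0 <= K)%R ->
  (forall n, oscillation m A (trunc n%:R u) <= K%:E) ->
  m.-integrable A (EFin \o u).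
Proof.
move=> K0 oscK; apply/integrableP; split; first exact/measurable_EFinP.
pose u_ n := trunc n%:R u; pose c_ n := avg m A (EFin \o u_ n).
pose I_ n := \int[m]_(x in A) `|(u_ n x)%:E - c_ n|.
have mu_ n : measurable_fun A (u_ n) by exact: measurable_trunc.
have mEu_ n : measurable_fun A (EFin \o u_ n) by exact/measurable_EFinP.
have mI n : measurable_fun A (fun x => `|(u_ n x)%:E - c_ n|).
  apply: measurableT_comp => //; apply: emeasurable_funB => //; exact: mEu_.
have cfin n : c_ n \is a fin_num.
  apply: avg_fin_num; apply: (integrable_bounded (M := n%:R)) => // x _.
  exact: le_norm_trunc.
pose a := fine (m A).
have aE : m A = a%:E by rewrite fineK// ge0_fin_numE.
have a0 : (0 < a)%R by rewrite fine_gt0// A0.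
have IK n : I_ n <= (K * a)%:E.
  have := oscK n; rewrite /oscillation -/(u_ n) -/(c_ n) /avg aE inver gt_eqF//.
  by rewrite lee_pdivrMl// -EFinM (mulrC K).
pose S_ (n : nat) := A `&` [set x | `|u x| <= n%:R]%R.
have mS n : measurable (S_ n).
  have -> : S_ n = A `&` u @^-1` `[(- n%:R)%R, n%:R].
    by apply/seteqP; split => x; rewrite /S_ /= in_itv/= ler_norml.
  apply: mu => //; exact: measurable_itv.
have [N SN] : exists N, 0 < m (S_ N).
  have cS : m (S_ n) @[n --> \oo] --> m A.
    apply: cvg_measure_exhaustion => //; first by move=> n x [].
    move=> x Ax; near=> n; split => //=; near: n; exact: nbhs_infty_ger.
  apply: contrapT => h.
  have S0 n : m (S_ n) = 0.
    by apply/eqP; rewrite -measure_le0 leNgt; apply/negP => Sn; apply: h; exists n.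
  move: cS; under eq_fun do rewrite S0.
  by move=> /(cvg_unique (@ereal_hausdorff R) (cvg_cst _))/esym A00; move: A0; rewrite A00 ltxx.
have SA : S_ N `<=` A by move=> x [].
pose s := fine (m (S_ N)).
have SNfin : m (S_ N) < +oo by rewrite (le_lt_trans _ Afin)// le_measure ?inE.
have sE : m (S_ N) = s%:E by rewrite fineK// ge0_fin_numE.
have s0 : (0 < s)%R by rewrite fine_gt0// SN.
have cB n : (N <= n)%N -> `|c_ n| <= (K * a / s + N%:R)%:E.
  move=> Nn.
  have : \int[m]_(x in S_ N) cst `|c_ n| x <=
         \int[m]_(x in S_ N) (`|(u_ n x)%:E - c_ n| + N%:R%:E).
    apply: ge0_le_integral => //.
      by move=> x _; exact: abse_ge0.
      by apply: emeasurable_funD => //; exact: measurable_funS (mI n).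
    move=> x [Ax uN] /=.
    have unx : u_ n x = u x by apply: trunc_id; rewrite (le_trans uN)// ler_nat.
    rewrite -(fineK (cfin n)) unx -EFinB !abse_EFin -EFinD lee_fin.
    have := (ler_normB (u x) (u x - fine (c_ n)))%R.
    by rewrite subKr; move: uN => /=; lra.
  rewrite integral_cst// ge0_integralD//; last exact: measurable_funS (mI n).
  have -> : \int[m]_(x in S_ N) N%:R%:E = N%:R%:E * m (S_ N).
    by rewrite -integral_cst.
  have : \int[m]_(x in S_ N) `|(u_ n x)%:E - c_ n| <= (K * a)%:E.
    by apply: le_trans (IK n); apply: ge0_subset_integral.
  rewrite sE -(fineK (cfin n)) abse_EFin -!EFinM.
  move=> /(leeD2r (N%:R * s)%:E) h /le_trans/(_ h).
  rewrite -EFinD !lee_fin -ler_pdivlMr//.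
  by rewrite mulrDl mulfK ?gt_eqF.
have cvg_int : \int[m]_(x in A) `|u_ n x|%:E @[n --> \oo] -->
    \int[m]_(x in A) `|u x|%:E.
  have lE x : A x -> limn (fun n => `|u_ n x|%:E) = `|u x|%:E.
    move=> Ax; apply/cvg_lim => //; apply: cvg_EFin; first exact: nearW.
    by apply: cvg_norm; exact: cvg_trunc.
  rewrite (eq_integral (fun x => limn (fun n => `|u_ n x|%:E))); last first.
    by move=> x xA; rewrite lE//; exact: set_mem.
  apply: cvg_monotone_convergence => //.
  - by move=> n; apply/measurable_EFinP; exact: measurableT_comp.
  - move=> x _ n k nk; rewrite lee_fin !norm_trunc ?ler0n//.
    by rewrite le_min !ge_min lexx orbT andbT ler_nat nk.
apply: (@le_lt_trans _ _ (K * a + (K * a / s + N%:R) * a)%:E); last exact: ltry.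
under eq_integral do rewrite /= ?abse_EFin.
apply: cvge_le cvg_int; near=> n.
have Nn : (N <= n)%N by near: n; exact: nbhs_infty_ge.
apply: (@le_trans _ _ (\int[m]_(x in A) (`|(u_ n x)%:E - c_ n| + `|c_ n|))).
  apply: ge0_le_integral => //.
  - by apply/measurable_EFinP; exact: measurableT_comp.
  - apply: emeasurable_funD => //; exact: mI.
  move=> x Ax; rewrite -(fineK (cfin n)) -EFinB !abse_EFin -EFinD lee_fin.
  by rewrite -{1}[u_ n x](subrK (fine (c_ n))) ler_normD.
rewrite ge0_integralD// EFinD leeD//; first exact: IK.
have -> : \int[m]_(x in A) `|c_ n| = `|c_ n| * m A by rewrite -integral_cst.
by rewrite aE EFinM lee_wpmul2r ?lee_fin ?(ltW a0)// cB.
Unshelve. all: by end_near. Qed.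

End integrability.

(** * Limits of Poincare inequalities *)

Section poincare_limit.
Context d (T : measurableType d) (R : realType).
Variable m : {measure set T -> \bar R}.
Local Open Scope ereal_scope.
Variables (B B' : set T) (B_ B'_ : (set T)^nat).
Hypotheses (mB_ : forall n, measurable (B_ n)) (mB : measurable B).
Hypotheses (subB : forall n, B_ n `<=` B).
Hypothesis (exhB : forall x, B x -> \forall n \near \oo, B_ n x).
Hypotheses (mB'_ : forall n, measurable (B'_ n)) (mB' : measurable B').
Hypotheses (subB' : forall n, B'_ n `<=` B').
Hypothesis (exhB' : forall x, B' x -> \forall n \near \oo, B'_ n x).
Hypotheses (BB' : B `<=` B') (B0 : 0 < m B) (B'fin : m B' < +oo).

(** The two sets, the function and its gradient may vary at once, which covers
    both the approximation of functions and that of balls. *)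
Lemma poincare_limit (K p : R) (u_ : (T -> R)^nat) (u : T -> R) Fu
    (g_ : (T -> \bar R)^nat) (g : T -> \bar R) Fg :
  (0 <= K)%R -> (0 < p)%R ->
  (forall n, measurable_fun B (u_ n)) -> measurable_fun B u ->
  {ae m, forall x, B x -> (u_ n x)%R @[n --> \oo] --> u x} ->
  m.-integrable B Fu ->
  (\forall n \near \oo, forall x, B x -> `|u_ n x|%:E <= Fu x) ->
  (forall n, measurable_fun B' (g_ n)) -> measurable_fun B' g ->
  {ae m, forall x, B' x -> g_ n x `^ p @[n --> \oo] --> g x `^ p} ->
  m.-integrable B' Fg ->
  (\forall n \near \oo, forall x, B' x -> g_ n x `^ p <= Fg x) ->
  (\forall n \near \oo, oscillation m (B_ n) (u_ n) <=
     K%:E * avg m (B'_ n) (fun x => g_ n x `^ p) `^ p^-1) ->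
  oscillation m B u <= K%:E * avg m B' (fun x => g x `^ p) `^ p^-1.
Proof.
move=> K0 p0 mu_ mu uu iFu uFu mg_ mg gg iFg gFg.
have B'0 : 0 < m B' by rewrite (lt_le_trans B0)// le_measure ?inE.
have Bfin : m B < +oo by rewrite (le_lt_trans _ B'fin)// le_measure ?inE.
have [|||gfin gcvg] := @cvg_avg _ _ _ m B'_ B' mB'_ mB' subB' exhB' B'fin B'0
  (fun n x => g_ n x `^ p) (fun x => g x `^ p) Fg _ _ gg iFg.
- by move=> n; exact: (measurableT_comp (measurable_poweR _) (mg_ n)).
- exact: (measurableT_comp (measurable_poweR _) mg).
- by apply: filterS gFg => n h x Bx; rewrite gee0_abs ?poweR_ge0 ?h.
move=> h; apply: (le_poweR_limit K0 _ _ gfin _ gcvg h).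
- by rewrite invr_gt0.
- by move=> n; apply: avg_ge0 => x _; exact: poweR_ge0.
- exact: cvg_oscillation iFu uFu.
Qed.

End poincare_limit.

(** * Lipschitz extensions *)

Section extension.
Context {R : realType} {X : metricType R}.

(** The data live on an index type mapped to X by phi, which covers both a
    function on a subset and a function on a space embedded in X. *)
Lemma mcshane_extension (I : Type) (phi : I -> X) (v : I -> R) (L : R) (i0 : I) :
  0 <= L -> (forall a b, v a - v b <= L * mdist (phi a) (phi b)) ->
  exists2 U : X -> R, (forall x y, `|U x - U y| <= L * mdist x y) &
    forall a, U (phi a) = v a.
Proof.
move=> L0 vL.
pose S x := [set v a - L * mdist x (phi a) | a in [set: I]].
have Sne x : S x !=set0 by exists (v i0 - L * mdist x (phi i0)), i0.
have Sub x a b : v a - L * mdist x (phi a) <= v b + L * mdist x (phi b).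
  have := vL a b; have := metric_triangle (phi a) x (phi b).
  move=> /(ler_wpM2l L0); rewrite (metric_sym (phi a) x); lra.
have hS x : has_sup (S x).
  split => //; exists (v i0 + L * mdist x (phi i0)) => _ [a _ <-]; exact: Sub.
have Uge x a : v a - L * mdist x (phi a) <= sup (S x).
  by apply: ub_le_sup; [exact: (hS x).2|exists a].
have half x y : sup (S x) - sup (S y) <= L * mdist x y.
  rewrite lerBlDr; apply: ge_sup => // _ [a _ <-].
  have := Uge y a; have := metric_triangle y x (phi a).
  move=> /(ler_wpM2l L0); rewrite (metric_sym y x); lra.
exists (fun x => sup (S x)) => [x y|a].
  by rewrite ler_norml half andbT lerNl opprB metric_sym half.
apply/eqP; rewrite eq_le; apply/andP; split.
  apply: ge_sup => // _ [b _ <-]; have := vL b a.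
  by rewrite (metric_sym (phi b)); lra.
by have := Uge (phi a) a; rewrite mdistxx mulr0 subr0.
Qed.

Lemma bounded_extension (A : set X) (u : X -> R) (M L : R) :
  0 <= L -> (forall x, `|u x| <= M) ->
  (forall x y, A x -> A y -> u x - u y <= L * mdist x y) ->
  exists U : X -> R, [/\ forall x y, `|U x - U y| <= L * mdist x y,
    forall x, `|U x| <= M & forall x, A x -> U x = u x].
Proof.
move=> L0 uM uL; have [[x0 Ax0]|A0] := pselect (exists x, A x); last first.
  exists (fun=> 0); split => [x y|x|x Ax].
  - by rewrite subrr normr0 mulr_ge0// mdist_ge0.
  - by rewrite normr0 (le_trans _ (uM x)).
  - by case: A0; exists x.
have [U UL Uu] := @mcshane_extension {x | A x} (fun x => sval x)
  (fun x => u (sval x)) L (exist _ x0 Ax0) L0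
  (fun x y => uL _ _ (svalP x) (svalP y)).
have M0 : 0 <= M by rewrite (le_trans _ (uM x0)).
exists (trunc M U); split => [x y|x|x Ax].
- exact: le_trans (trunc_contract _ _ _ _) (UL x y).
- exact: le_norm_trunc.
- by rewrite trunc_id (Uu (exist _ x Ax)).
Qed.

End extension.

(** * Poincare inequalities for slopes and for upper gradients *)

Section borel_regular.
Context {R : realType} {X : pmetricType R}.
Variable mu : {outer_measure set X -> \bar R}.
Local Notation m := (mu : set (caratheodory_type mu) -> \bar R).
Local Open Scope ereal_scope.
Hypothesis borel_cara : forall A : set X, <<s @open X >> A ->
  mu.-caratheodory A.
Hypothesis ball_fin : forall (x : X) (r : R), mu (ball x r) < +oo.

Lemma borel_fun_cara d (T : measurableType d) (f : X -> T)
    (D : set (caratheodory_type mu)) :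
  borel_fun f -> measurable D -> measurable_fun D f.
Proof.
move=> bf mD; apply: (@measurable_funS _ _ _ _ setT) => // _ B mB.
by apply: borel_cara; exact: bf.
Qed.

Lemma ball_cara (x : X) (r : R) :
  measurable (ball x r : set (caratheodory_type mu)).
Proof.
by apply: borel_cara; apply: sub_sigma_algebra; exact: open_metric_ball.
Qed.

Lemma oscillation_null (x : X) (r : R) (u : X -> R) : borel_fun u ->
  mu (ball x r) = 0 -> oscillation m (ball x r) u = 0.
Proof.
move=> bu B0; apply: avg_null => //; first exact: ball_cara.
apply: measurableT_comp => //; apply: emeasurable_funB => //.
by apply/measurable_EFinP; apply: borel_fun_cara => //; exact: ball_cara.
Qed.

Lemma lipschitz_bounded_ball (u : X -> R) (L : R) (x : X) (r : R) :
  (0 <= L)%R -> (forall x y, `|u x - u y| <= L * mdist x y)%R ->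
  forall y, ball x r y -> (`|u y| <= `|u x| + L * r)%R.
Proof.
move=> L0 uL y; rewrite ballEmdist/= => xy.
have := ler_distD (u x) (u y) 0%R; rewrite !subr0 => /le_trans; apply.
rewrite addrC lerD2l (le_trans (uL _ _))// metric_sym ler_wpM2l//.
exact: ltW.
Qed.

Lemma integrable_ball_bounded (x : X) (r b : R) (f : X -> \bar R) :
  borel_fun f -> (forall y, ball x r y -> `|f y| <= b%:E) ->
  m.-integrable (ball x r) f.
Proof.
move=> bf fb; have mB := ball_cara x r.
apply/integrableP; split; first exact: borel_fun_cara.
apply: (@le_lt_trans _ _ (\int[m]_(y in ball x r) cst b%:E y)).
  apply: ge0_le_integral => //.
  - by apply: measurableT_comp => //; exact: borel_fun_cara.
have Bfin : m (ball x r) \is a fin_num by rewrite ge0_fin_numE.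
have -> : \int[m]_(y in ball x r) cst b%:E y = b%:E * m (ball x r).
  exact: integral_cst.
by rewrite -(fineK Bfin) -EFinM ltry.
Qed.

Lemma poincare_limit_ball (x : X) (r r' K p : R) (u_ : (X -> R)^nat)
    (u : X -> R) Fu (g_ : (X -> \bar R)^nat) (g : X -> \bar R) Fg :
  (r <= r')%R -> 0 < m (ball x r) -> (0 <= K)%R -> (0 < p)%R ->
  (forall n, borel_fun (u_ n)) -> borel_fun u ->
  {ae m, forall y, ball x r y -> (u_ n y)%R @[n --> \oo] --> u y} ->
  m.-integrable (ball x r) Fu ->
  (\forall n \near \oo, forall y, ball x r y -> `|u_ n y|%:E <= Fu y) ->
  (forall n, borel_fun (g_ n)) -> borel_fun g ->
  {ae m, forall y, ball x r' y -> g_ n y `^ p @[n --> \oo] --> g y `^ p} ->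
  m.-integrable (ball x r') Fg ->
  (\forall n \near \oo, forall y, ball x r' y -> g_ n y `^ p <= Fg y) ->
  (\forall n \near \oo, oscillation m (ball x r) (u_ n) <=
     K%:E * avg m (ball x r') (fun y => g_ n y `^ p) `^ p^-1) ->
  oscillation m (ball x r) u <=
    K%:E * avg m (ball x r') (fun y => g y `^ p) `^ p^-1.
Proof.
move=> rr' B0 K0 p0 bu_ bu uu iFu uFu bg_ bg gg iFg gFg.
have mB s := ball_cara x s.
apply: (@poincare_limit _ _ _ m (ball x r) (ball x r')
  (fun=> ball x r) (fun=> ball x r')) iFu _ _ _ _ iFg _ => //.
- by move=> n.
- by move=> y By; exact: nearW.
- by move=> n.
- by move=> y By; exact: nearW.
- exact: le_ball.
- exact: ball_fin.
- by move=> n; exact: borel_fun_cara.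
- exact: borel_fun_cara.
- by move=> n; exact: borel_fun_cara.
- exact: borel_fun_cara.
Qed.

Definition poincare_on (p K : R) (x : X) (r r' : R) (u : X -> R)
    (g : X -> \bar R) : Prop :=
  oscillation m (ball x r) u <=
    K%:E * avg m (ball x r') (fun y => g y `^ p) `^ p^-1.

Lemma poincare_on_null p K x r r' u g : (0 <= K)%R -> borel_fun u ->
  mu (ball x r) = 0 -> poincare_on p K x r r' u g.
Proof.
move=> K0 bu B0; rewrite /poincare_on oscillation_null//.
by rewrite mule_ge0// poweR_ge0.
Qed.

(** The slopes of u at the scales 1 / (n + 1) converge to lip u below the
    Lipschitz constant. *)
Lemma poincare_lip_of_UG p K x r r' (u : X -> R) :
  (0 < p)%R -> (0 <= K)%R -> (r <= r')%R -> lipschitz_fun u ->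
  (forall (e e' : R), (0 < e')%R -> (e' < e)%R ->
     poincare_on p K x r r' u (scale_slope u e)) ->
  poincare_on p K x r r' u (lip u).
Proof.
move=> p0 K0 rr' lipu UGu; have bu := lipschitz_borel lipu.
have [B0|] := eqVneq (mu (ball x r)) 0; first exact: poincare_on_null.
rewrite neq_lt ltNge outer_measure_ge0/= => B0.
have blip := lip_borel lipu.
have [L L0 uL] := lipschitz_funP lipu.
have slopeL n y := scale_slope_le n.+1%:R^-1 y L0 uL.
have lipL y : lip u y <= L%:E.
  by apply: lip_le ltr01 _ => // z _; rewrite distrC.
apply: (@poincare_limit_ball x r r' K p (fun=> u) u (cst (`|u x| + L * r)%:E)
  (fun n => scale_slope u n.+1%:R^-1) (lip u) (cst (L `^ p)%:E)) => //.
- by apply: aeW => y _; exact: cvg_cst.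
- apply: (@integrable_ball_bounded _ _ `| `|u x| + L * r |%R) => //.
  exact: measurable_cst.
- by apply: nearW => n y xy; rewrite lee_fin (lipschitz_bounded_ball L0 uL xy).
- by move=> n; exact: scale_slope_borel uL.
- apply: aeW => y _; apply: cvg_poweR => //.
  + by move=> n; exact: scale_slope_ge0.
  + by rewrite ge0_fin_numE ?lip_ge0// (le_lt_trans (lipL y))// ltry.
  + exact: cvg_scale_slope.
- apply: (@integrable_ball_bounded _ _ `| L `^ p |%R) => //.
  exact: measurable_cst.
- apply: nearW => n y _; rewrite -poweR_EFin; apply: le_poweR => //.
  + exact: ltW.
  + exact: scale_slope_ge0.
- apply: nearW => n; have n0 : (0 < n.+1%:R^-1 :> R)%R by rewrite invr_gt0.
  apply: (UGu n.+1%:R^-1%R (n.+1%:R^-1 / 2)%R); first exact: divr_gt0.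
  by rewrite ltr_pdivrMr// ltr_pMr// ltr1n.
Qed.

Lemma le_poincare_rhs (K p : R) (x : X) (r : R) (g h : X -> \bar R) :
  (0 <= K)%R -> (0 < p)%R -> borel_fun g -> borel_fun h ->
  (forall y, 0 <= g y) -> (forall y, g y <= h y) ->
  K%:E * avg m (ball x r) (fun y => g y `^ p) `^ p^-1 <=
  K%:E * avg m (ball x r) (fun y => h y `^ p) `^ p^-1.
Proof.
move=> K0 p0 bg bh g0 gh; apply: lee_wpmul2l => //; apply: le_poweR.
- by rewrite invr_ge0 ltW.
- by apply: avg_ge0 => y _; exact: poweR_ge0.
have mB := ball_cara x r.
apply: le_avg => // [| |y _|y _]; last 2 first.
- exact: poweR_ge0.
- by apply: le_poweR => //; exact: ltW.
- exact: (measurableT_comp (measurable_poweR _) (borel_fun_cara bg mB)).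
- exact: (measurableT_comp (measurable_poweR _) (borel_fun_cara bh mB)).
Qed.

(** Limit of the inequality for the approximations of [two_sided_approx] with
    e = 1 / (k + 1). *)
Lemma poincare_of_lip_bounded (p K : R) (x : X) (r r' : R) (U G : X -> R)
    (a b eps : R) :
  (0 < p)%R -> (0 <= K)%R -> (r <= r')%R -> lipschitz_fun U ->
  borel_fun (EFin \o G) ->
  (0 < a)%R -> (forall y, a <= G y <= b)%R -> (0 < eps)%R ->
  (forall y z, mdist y z <= eps ->
    `|U y - U z| <= Num.max (G y) (G z) * mdist y z)%R ->
  (forall w, lipschitz_fun w -> poincare_on p K x r r' w (lip w)) ->
  poincare_on p K x r r' U (EFin \o G).
Proof.
move=> p0 K0 rr' lipU bG a0 aGb eps0 UG piw; have bU := lipschitz_borel lipU.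
have [B0|] := eqVneq (mu (ball x r)) 0; first exact: poincare_on_null.
rewrite neq_lt ltNge outer_measure_ge0/= => B0.
have [L L0 UL] := lipschitz_funP lipU.
have e0 (k : nat) : (0 < k.+1%:R^-1 :> R)%R by rewrite invr_gt0.
have e1 (k : nat) : (k.+1%:R^-1 <= 1 :> R)%R by rewrite invf_le1// ler1n.
have /choice[w wP] : forall k : nat, exists w : X -> R,
    [/\ lipschitz_fun w, forall y, (`|w y - U y| <= k.+1%:R^-1)%R &
      forall y, lip w y <= ((1 + k.+1%:R^-1) * G y)%:E].
  move=> k.
  have [w [[L' _ lipw] wU] [e' e'0 we]] :=
    two_sided_approx L0 UL a0 aGb eps0 UG (e0 k).
  exists w; split => //; first by exists L'.
  move=> y; apply: (lip_le _ e'0) => [|z].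
    rewrite mulr_ge0// ?addr_ge0 ?(ltW (e0 k))//.
    by rewrite (le_trans (ltW a0))//; case/andP: (aGb y).
  by rewrite ballEmdist/= => /ltW; exact: we.
have G0 y : (0 <= G y)%R by rewrite (le_trans (ltW a0))//; case/andP: (aGb y).
have bGk (k : nat) : borel_fun (fun y => ((1 + k.+1%:R^-1) * G y)%:E).
  apply/measurable_EFinP; apply: measurable_funM => //.
  exact/measurable_EFinP.
have cvge : (k.+1%:R^-1 : R)%R @[k --> \oo] --> 0%R by exact: cvg_harmonic.
apply: (@poincare_limit_ball x r r' K p w U (cst (`|U x| + L * r + 1)%:E)
  (fun k y => ((1 + k.+1%:R^-1) * G y)%:E) _ (cst ((2 * b) `^ p)%:E)) => //.
- by move=> k; have [/lipschitz_borel] := wP k.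
- apply: aeW => y _; apply/cvgrPdist_le => e /[dup] e00.
  move/cvgrPdist_le : cvge => /[apply]; apply: filterS => k.
  rewrite sub0r normrN (ger0_norm (ltW (e0 k))) => ke.
  by have [_ wU _] := wP k; rewrite distrC (le_trans (wU y)).
- apply: (@integrable_ball_bounded _ _ `| `|U x| + L * r + 1 |%R) => //.
  exact: measurable_cst.
- apply: nearW => k y xy; rewrite lee_fin.
  have := lipschitz_bounded_ball L0 UL xy; have [_ wU _] := wP k.
  have := (ler_distD (U y) (w k y) 0)%R; rewrite !subr0.
  have := le_trans (wU y) (e1 k); lra.
- apply: aeW => y _; apply: cvg_poweR => //.
    by move=> k; rewrite lee_fin mulr_ge0// addr_ge0// ltW.
  apply: cvg_EFin; first exact: nearW.
  rewrite -[X in _ --> X]mul1r; apply: cvgMl.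
  by rewrite -[X in _ --> X]addr0; apply: cvgD => //; exact: cvg_cst.
- apply: (@integrable_ball_bounded _ _ `|(2 * b) `^ p |%R) => //.
  exact: measurable_cst.
- apply: nearW => k y _; rewrite -poweR_EFin; apply: le_poweR => //.
  + exact: ltW.
  + by rewrite lee_fin mulr_ge0// addr_ge0// ltW.
  + have /andP[ay yb] := aGb y; rewrite lee_fin ler_pM// ?addr_ge0 ?(ltW (e0 k))//.
    by rewrite -[2%R]/(1 + 1)%R lerD2l.
apply: nearW => k; have [lipw _ wG] := wP k.
apply: le_trans (piw _ lipw) _; apply: le_poincare_rhs => //.
  exact: lip_borel.
by move=> y; exact: lip_ge0.
Qed.

(** The step inequality becomes the hypothesis of [poincare_of_lip_bounded]
    once u is replaced by a Lipschitz extension of its restriction to the set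
    where g <= T and g by a function between two positive constants. *)
Lemma poincare_UG_bounded (p K : R) (x : X) (r r' : R) (u : X -> R)
    (g : X -> \bar R) (M eps : R) :
  (0 < p)%R -> (0 <= K)%R -> (r <= r')%R -> borel_fun u ->
  (forall y, `|u y| <= M)%R -> (0 < eps)%R -> UG eps u g ->
  m.-integrable (ball x r') (fun y => g y `^ p) ->
  (forall w, lipschitz_fun w -> poincare_on p K x r r' w (lip w)) ->
  poincare_on p K x r r' u g.
Proof.
move=> p0 K0 rr' bu uM eps0 UGg intg piw.
have [bg g0 _] := UGg.
have [B0|] := eqVneq (mu (ball x r)) 0; first exact: poincare_on_null.
rewrite neq_lt ltNge outer_measure_ge0/= => B0.
(* T n * eps >= 2 * M makes u Lipschitz with constant T n also between points
   farther apart than eps. *)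
pose T (n : nat) := (n%:R + Num.max 1 (2 * M / eps))%R.
have T1 n : (n.+1%:R <= T n)%R by rewrite -natr1 lerD2l le_max lexx.
have T1' n : (1 <= T n)%R by rewrite (le_trans _ (T1 n))// ler1n.
have T0 n : (0 < T n)%R by rewrite (lt_le_trans ltr01).
have TM n : (2 * M <= T n * eps)%R.
  rewrite -ler_pdivrMr// /T; apply: le_trans (_ : Num.max 1 (2 * M / eps) <= _)%R.
    by rewrite le_max lexx orbT.
  by rewrite lerDr.
clearbody T.
pose G (n : nat) y := if g y <= (T n)%:E then Num.max (fine (g y)) (T n)^-1%R
               else (2 * T n)%R.
have TV n : ((T n)^-1 <= 1)%R by rewrite invf_le1.
have T2 n : (T n <= 2 * T n)%R by have := T0 n; lra.
have TV2 n : ((T n)^-1 <= 2 * T n)%R.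
  exact: le_trans (TV n) (le_trans (T1' n) (T2 n)).
have aGb n y : ((T n)^-1 <= G n y <= 2 * T n)%R.
  rewrite /G; case: ifPn => gT; last by rewrite TV2 lexx.
  rewrite le_max lexx orbT ge_max TV2 andbT/=; apply: le_trans (T2 n).
  by rewrite -lee_fin fineK// ge0_fin_numE// (le_lt_trans gT)// ltry.
have fing n y : g y <= (T n)%:E -> g y \is a fin_num.
  by move=> gT; rewrite ge0_fin_numE// (le_lt_trans gT)// ltry.
have step y z : (mdist y z <= eps)%R -> g y \is a fin_num -> g z \is a fin_num ->
    (`|u y - u z| <= (fine (g y) + fine (g z)) / 2 * mdist y z)%R.
  move=> yz fy fz; have := UG_step UGg yz.
  by rewrite -(fineK fy) -(fineK fz) inver pnatr_eq0/= -!EFinM lee_fin.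
have uT n y z : g y <= (T n)%:E -> g z <= (T n)%:E ->
    (u y - u z <= T n * mdist y z)%R.
  move=> gy gz; apply: le_trans (ler_norm _) _.
  have [yz|yz] := leP (mdist y z) eps.
    apply: le_trans (step _ _ yz (fing _ _ gy) (fing _ _ gz)) _.
    rewrite ler_wpM2r ?mdist_ge0//.
    have : (fine (g y) <= T n)%R by rewrite -lee_fin fineK// (fing n).
    have : (fine (g z) <= T n)%R by rewrite -lee_fin fineK// (fing n).
    lra.
  apply: (le_trans (ler_normB _ _)).
  have : (T n * eps <= T n * mdist y z)%R by rewrite ler_wpM2l// ltW.
  by have := uM y; have := uM z; have := TM n; lra.
have /choice[U UP] : forall n, exists U : X -> R,
    [/\ forall y z, (`|U y - U z| <= T n * mdist y z)%R,
      forall y, (`|U y| <= M)%R & forall y, g y <= (T n)%:E -> U y = u y].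
  move=> n; have := @bounded_extension _ _ [set y | g y <= (T n)%:E] u M (T n).
  by apply => //; [exact: ltW|move=> y z; exact: uT].
have bG n : borel_fun (EFin \o G n).
  have -> : EFin \o G n = (fun y => if g y <= (T n)%:E
      then maxe (g y) (T n)^-1%:E else (2 * T n)%:E).
    apply/funext => y /=; rewrite /G; case: ifPn => // gT.
    by rewrite -{2}(fineK (fing _ _ gT)) EFin_max.
  apply: measurable_fun_ifT => //.
  - apply: (measurable_fun_bool true).
    rewrite (_ : _ @^-1` _ = [set y | g y <= (T n)%:E])//.
    by have := emeasurable_fun_infty_c measurableT bg (T n)%:E; rewrite setTI.
  - by apply: measurable_maxe.
have piUG n : poincare_on p K x r r' (U n) (EFin \o G n).
  have [UL UM Uu] := UP n.
  apply: (@poincare_of_lip_bounded p K x r r' (U n) (G n) (T n)^-1 (2 * T n) eps)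
    => //.
  - by exists (T n).
  - by rewrite invr_gt0.
  move=> y z yz; have d0 : (0 <= mdist y z)%R by exact: mdist_ge0.
  have [gy|gy] := boolP (g y <= (T n)%:E); last first.
    apply: le_trans (UL y z) _; rewrite ler_wpM2r// le_max /G (negbTE gy).
    by rewrite ler_peMl ?(ltW (T0 n))// ler1n.
  have [gz|gz] := boolP (g z <= (T n)%:E); last first.
    apply: le_trans (UL y z) _; rewrite ler_wpM2r// le_max /G (negbTE gz).
    by rewrite orbC ler_peMl ?(ltW (T0 n))// ler1n.
  rewrite !Uu//; apply: le_trans (step _ _ yz (fing _ _ gy) (fing _ _ gz)) _.
  rewrite ler_wpM2r// /G gy gz.
  set a := fine (g y); set b := fine (g z).
  have : (a <= Num.max (Num.max a (T n)^-1) (Num.max b (T n)^-1))%R.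
    by rewrite !le_max lexx.
  have : (b <= Num.max (Num.max a (T n)^-1) (Num.max b (T n)^-1))%R.
    by rewrite !le_max lexx orbT.
  lra.
have mB' := ball_cara x r'.
have aeg : {ae m, forall y, ball x r' y -> g y \is a fin_num}.
  apply: filterS (integrable_ae mB' intg) => y h By; move: (h By).
  by rewrite !ge0_fin_numE ?poweR_ge0//; apply: lty_poweRy; rewrite gt_eqF.
have nearT y : g y \is a fin_num -> \forall n \near \oo, g y <= (T n)%:E.
  move=> gfin; near=> n; rewrite -(fineK gfin) lee_fin.
  rewrite (le_trans _ (T1 n))// ltW// -natr1 ltr_wpDr//.
  by near: n; exact: nbhs_infty_gtr.
(* Domination: max(g, 1/T) <= max(2g, 1) where g <= T, as T >= 1, and 2T <= 2g
   elsewhere. *)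
apply: (@poincare_limit_ball x r r' K p U u (cst M%:E)
  (fun n => EFin \o G n) g (fun y => (2%:E * g y) `^ p + 1)) => //.
- by move=> n; apply: lipschitz_borel; have [UL _ _] := UP n; exists (T n).
- apply: (@filterS _ _ (ae_filter_ringOfSetsType m) _ _ _ aeg) => y h By; have gfin := h (le_ball rr' By).
  apply: cvg_near_cst; apply: filterS (nearT y gfin) => n gT.
  by have [_ _ ->] := UP n.
- apply: (@integrable_ball_bounded _ _ `|M|%R) => //.
  exact: measurable_cst.
- by apply: nearW => n y _; rewrite lee_fin; have [_ UM _] := UP n.
- apply: (@filterS _ _ (ae_filter_ringOfSetsType m) _ _ _ aeg) => y h By; have gfin := h By.
  apply: cvg_poweR => //.
    move=> n; rewrite lee_fin; have /andP[+ _] := aGb n y.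
    by apply: le_trans; rewrite invr_ge0 ltW.
  rewrite -(fineK gfin); apply: cvg_EFin; first exact: nearW.
  apply/cvgrPdist_le => e e0.
  have cvge : (k.+1%:R^-1 : R)%R @[k --> \oo] --> 0%R by exact: cvg_harmonic.
  move/cvgrPdist_le : cvge => /(_ _ e0) ne.
  apply: filterS2 ne (nearT y gfin) => n.
  rewrite sub0r normrN ger0_norm ?invr_ge0// => ne gT /=; rewrite /G gT.
  have Tn : ((T n)^-1 <= n.+1%:R^-1)%R by rewrite lef_pV2 ?posrE.
  have TV0 : (0 < (T n)^-1)%R by rewrite invr_gt0.
  have gy0 : (0 <= fine (g y))%R by rewrite fine_ge0.
  move: TV0 (le_trans Tn ne); move: (T n)^-1%R => t t0 te.
  by rewrite distrC; case: (leP (fine (g y)) t) => ?; rewrite ler_norml; apply/andP; split; lra.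
- apply: integrableD => //.
    rewrite (_ : (fun y => _) = (fun y => (2 `^ p)%:E * g y `^ p)).
      exact: integrableZl.
    by apply/funext => y; rewrite poweRM ?lee_fin.
  apply: (@integrable_ball_bounded _ _ 1%R) => //; first exact: measurable_cst.
  by move=> y _; rewrite /= normr1.
- apply: nearW => n y _.
  have G0 : 0 <= (EFin \o G n) y.
    rewrite lee_fin; have /andP[+ _] := aGb n y.
    by apply: le_trans; rewrite invr_ge0 ltW.
  have : (EFin \o G n) y <= 2%:E * g y \/ (EFin \o G n) y <= 1.
    rewrite /= /G; case: ifPn => gT; last first.
      left; rewrite EFinM lee_wpmul2l ?lee_fin//.
      by move: gT; rewrite -ltNge => /ltW.
    have -> : 2%:E * g y = (2 * fine (g y))%:E by rewrite EFinM fineK ?(fing n).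
    rewrite !lee_fin.
    have gy0 : (0 <= fine (g y))%R by rewrite fine_ge0.
    by case: (leP (fine (g y)) (T n)^-1%R) => h; [right; exact: TV|left; lra].
  case => /(le_poweR (ltW p0) G0) h; apply: le_trans h _.
    by rewrite leeDl.
  by rewrite poweR1r leeDr// poweR_ge0.
by apply: nearW => n; exact: piUG.
Unshelve. all: by end_near. Qed.

Lemma UG_trunc (M eps : R) (u : X -> R) g : UG eps u g -> UG eps (trunc M u) g.
Proof.
move=> [bg g0 ug]; split => // N q /ug; apply: le_trans.
by rewrite lee_fin; exact: trunc_contract.
Qed.

(** If the right-hand side is infinite there is nothing to prove.  Otherwise it
    bounds the oscillations of all the truncations of u, which share the upper
    gradient g. *)
Lemma poincare_UG_of_lip (p K : R) (x : X) (r r' : R) (u : X -> R) g :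
  (0 < p)%R -> (0 < K)%R -> (r <= r')%R -> UG_couples (u, g) ->
  (forall w, lipschitz_fun w -> poincare_on p K x r r' w (lip w)) ->
  poincare_on p K x r r' u g.
Proof.
move=> p0 K0 rr' [/= bu [eps eps0 UGg]] piw; have [bg g0 _] := UGg.
have [B0|] := eqVneq (mu (ball x r)) 0.
  by apply: poincare_on_null => //; exact: ltW.
rewrite neq_lt ltNge outer_measure_ge0/= => B0.
have mB := ball_cara x r; have mB' := ball_cara x r'.
have B'0 : 0 < mu (ball x r').
  by rewrite (lt_le_trans B0)// le_outer_measure//; exact: le_ball.
have B'fin := ball_fin x r'.
have bgp : measurable_fun (ball x r' : set (caratheodory_type mu))
    (fun y => g y `^ p).
  exact: (measurableT_comp (measurable_poweR _) (borel_fun_cara bg mB')).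
have gp0 : 0 <= \int[m]_(y in ball x r') (g y `^ p).
  by apply: integral_ge0 => y _; exact: poweR_ge0.
have [intgy|intg] := eqVneq (\int[m]_(y in ball x r') (g y `^ p)) +oo.
  rewrite /poincare_on.
  have -> : avg m (ball x r') (fun y => g y `^ p) = +oo.
    transitivity ((mu (ball x r'))^-1 * +oo); first by congr (_ * _).
    by rewrite gt0_muley// inve_gt0//; [rewrite gt_eqF|rewrite lt_eqF].
  by rewrite poweRyr ?invr_neq0 ?gt_eqF// gt0_muley ?lte_fin// leey.
have ig : m.-integrable (ball x r') (fun y => g y `^ p).
  apply/integrableP; split => //.
  under eq_integral do rewrite gee0_abs ?poweR_ge0//.
  by rewrite lt_neqAle intg leey.
have avgfin : avg m (ball x r') (fun y => g y `^ p) \is a fin_num.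
  by apply: avg_fin_num.
set b := K%:E * avg m (ball x r') (fun y => g y `^ p) `^ p^-1.
have bfin : b \is a fin_num by rewrite fin_numM// fin_num_poweR.
have b0 : 0 <= b by rewrite mule_ge0 ?poweR_ge0// lee_fin ltW.
have btr n : borel_fun (trunc n%:R u) by apply: measurable_trunc.
have pitr n : poincare_on p K x r r' (trunc n%:R u) g.
  apply: (@poincare_UG_bounded p K x r r' (trunc n%:R u) g n%:R eps) => //.
  - exact: ltW.
  - by move=> y; exact: le_norm_trunc.
  - exact: UG_trunc.
have iu : m.-integrable (ball x r) (EFin \o u).
  apply: (@integrable_of_trunc _ _ _ m (ball x r) u mB _ B0 _ (fine b)).
  - exact: ball_fin.
  - exact: borel_fun_cara.
  - by rewrite fine_ge0.
  - by move=> n; rewrite fineK//; exact: pitr.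
apply: (@poincare_limit_ball x r r' K p (fun n => trunc n%:R u) u
  (abse \o (EFin \o u)) (fun=> g) g (fun y => g y `^ p)) => //.
- exact: ltW.
- by apply: aeW => y _; exact: cvg_trunc.
- exact: integrable_abse.
- by apply: nearW => n y _; rewrite lee_fin; exact: le_trunc_norm.
- by apply: aeW => y _; exact: cvg_cst.
- by apply: nearW => n y _.
- by apply: nearW => n; exact: pitr.
Qed.

End borel_regular.

Arguments poincare_on {R X} mu p K x r r' u g.

(** * The completion *)

Section completion.
Context {R : realType} {X : pmetricType R}.
Variable mu : {outer_measure set X -> \bar R}.
Local Open Scope ereal_scope.
Hypothesis borel_cara : forall A : set X, <<s @open X >> A ->
  mu.-caratheodory A.
Hypothesis ball_fin : forall (x : X) (r : R), mu (ball x r) < +oo.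
Variables (Y : completeMetricType R) (i : X -> Y).
Hypothesis i_isom : forall x y, mdist (i x) (i y) = mdist x y.
Hypothesis i_dense : dense (range i).
Local Notation nu := (completion_measure mu i : {outer_measure set Y -> \bar R}).
Local Notation m := (mu : set (caratheodory_type mu) -> \bar R).
Local Notation n := (nu : set (caratheodory_type nu) -> \bar R).

Lemma isometry_inj : injective i.
Proof.
by move=> x y xy; apply: mdist_positivity; rewrite -i_isom xy mdistxx.
Qed.

Lemma preimage_ball x r : i @^-1` ball (i x) r = ball x r.
Proof. by apply/seteqP; split => y; rewrite /= !ballEmdist/= i_isom. Qed.

Lemma dense_meets (O : set Y) (y : Y) : open O -> O y -> exists x, O (i x).
Proof.
move=> oO Oy; have O0 : O !=set0 by exists y.
by have [z [Oz [x _ xz]]] := i_dense O0 oO; exists x; rewrite xz.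
Qed.

Lemma dense_pointP (y : Y) (e : R) : (0 < e)%R ->
  exists x, (mdist (i x) y < e)%R.
Proof.
move=> e0; have [x] := dense_meets (open_metric_ball y e) (ballxx y e0).
by rewrite ballEmdist/= metric_sym; exists x.
Qed.

Lemma preimage_open (U : set Y) : open U -> open (i @^-1` U).
Proof.
rewrite openE => oU; apply: open_ballP => x Uix.
have := oU _ Uix; rewrite /interior => /nbhs_ballP[e /= e0 eU].
by exists e => // y xy; apply: eU; rewrite -preimage_ball in xy.
Qed.

Lemma preimage_borel (A : set Y) : <<s @open Y >> A ->
  <<s @open X >> (i @^-1` A).
Proof.
have mi : measurable_fun [set: g_sigma_algebraType (@open X)]
    (i : g_sigma_algebraType (@open X) -> g_sigma_algebraType (@open Y)).
  apply: (@measurability _ _ (g_sigma_algebraType (@open X))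
    (g_sigma_algebraType (@open Y)) _ _ (@open Y)) => //.
  move=> _ [U oU <-]; rewrite setTI; apply: sub_sigma_algebra.
  exact: preimage_open.
by move=> bA; rewrite -[_ @^-1` _]setTI; exact: mi.
Qed.

Let nuE B : nu B = mu (i @^-1` B). Proof. by []. Qed.

Lemma completion_borel_cara (A : set Y) : <<s @open Y >> A ->
  nu.-caratheodory A.
Proof.
move=> /preimage_borel/borel_cara cA E.
by rewrite !nuE !preimage_setI preimage_setC; exact: cA.
Qed.

Lemma completion_ball_fin (y : Y) (r : R) : nu (ball y r) < +oo.
Proof.
have [x xy] := dense_pointP y ltr01.
apply: le_lt_trans (ball_fin x (1 + r)).
apply: (@le_outer_measure _ _ mu (i @^-1` ball y r)) => z /=.
rewrite !ballEmdist/= => yz; rewrite -i_isom.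
by rewrite (le_lt_trans (metric_triangle _ y _))// ltrD.
Qed.

(** A Caratheodory set A of Y splits in particular the images of the subsets of
    X, and i is injective, so its preimage splits every subset of X. *)
Lemma measurable_embedding : measurable_fun [set: caratheodory_type mu]
  (i : caratheodory_type mu -> caratheodory_type nu).
Proof.
move=> _ A cA; rewrite setTI.
suff : mu.-caratheodory (i @^-1` A) by [].
move=> E; have := (cA : nu.-caratheodory A) (i @` E); rewrite !nuE.
have iE B : i @^-1` (i @` E `&` B) = E `&` i @^-1` B.
  apply/seteqP; split => [x [[z Ez /isometry_inj <-] Bx]//|x [Ex Bx]].
  by split => //; exists x.
have -> : i @^-1` (i @` E) = E.
  by rewrite -[i @` E]setIT iE preimage_setT setIT.
by rewrite !iE.
Qed.

Lemma integral_completion (A : set Y) (f : Y -> \bar R) :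
  measurable (A : set (caratheodory_type nu)) ->
  measurable_fun (A : set (caratheodory_type nu)) f ->
  \int[n]_(y in A) f y = \int[m]_(x in i @^-1` A) f (i x).
Proof.
move=> mA mf; rewrite [LHS]integralE [RHS]integralE; congr (_ - _).
  rewrite (_ : (fun x => f (i x))^\+ = f^\+ \o i); last first.
    by apply/funext => x; rewrite /= !unlock.
  apply: (ge0_integral_pushforward measurable_embedding) => //.
  exact: measurable_funepos.
rewrite (_ : (fun x => f (i x))^\- = f^\- \o i); last first.
  by apply/funext => x; rewrite /= !unlock.
apply: (ge0_integral_pushforward measurable_embedding) => //.
exact: measurable_funeneg.
Qed.

Lemma avg_completion (A : set Y) (f : Y -> \bar R) :
  measurable (A : set (caratheodory_type nu)) ->
  measurable_fun (A : set (caratheodory_type nu)) f ->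
  avg n A f = avg m (i @^-1` A) (f \o i).
Proof. by move=> mA mf; rewrite /avg; congr (_ * _); exact: integral_completion. Qed.

Lemma oscillation_completion (A : set Y) (u : Y -> R) :
  measurable (A : set (caratheodory_type nu)) ->
  measurable_fun (A : set (caratheodory_type nu)) u ->
  oscillation n A u = oscillation m (i @^-1` A) (u \o i).
Proof.
move=> mA mu'.
have mEu : measurable_fun (A : set (caratheodory_type nu)) (EFin \o u).
  exact/measurable_EFinP.
have cE := avg_completion mA mEu.
rewrite /oscillation; move: (avg n A (EFin \o u)) cE => c cE.
have mf : measurable_fun (A : set (caratheodory_type nu))
    (fun y => `|(EFin \o u) y - c|).
  apply: (measurableT_comp (@abse_measurable R setT)).
  exact: (emeasurable_funB mEu (measurable_cst c)).
rewrite (avg_completion mA mf); congr (avg m _ _).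
by apply/funext => x /=; rewrite cE.
Qed.

(** Any difference quotient of u with an end in Y is approached by quotients
    with that end in the image of X: those exceeding a given value form an
    open set, which the dense image meets if it is nonempty. *)
Lemma slope_completion (u : Y -> R) (L e : R) (x : X) : (0 <= L)%R ->
  (forall y z, `|u y - u z| <= L * mdist y z)%R ->
  slope u (i x) e = slope (u \o i) x e.
Proof.
move=> L0 uL; apply/eqP; rewrite eq_le; apply/andP; split; last first.
  apply: ereal_sup_le => _ [y [xy yx] <-]; exists (i y).
    by split; [move: xy; rewrite -preimage_ball|move=> /isometry_inj].
  by rewrite /= i_isom.
apply: ge_ereal_sup => _ [y [xy yx] <-].
apply/lee_subgt0Pr => t t0; rewrite -EFinB.
set a := (_ - t)%R.
have d0 : (0 < mdist (i x) y)%R by rewrite mdist_gt0; apply/eqP => /esym.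
pose F z := (`|u z - u (i x)| - a * mdist (i x) z)%R.
have oF : open [set z | (0 < F z)%R].
  apply: lipschitz_open_gt; exists (L + `|a|)%R => z w.
  have -> : (F z - F w = (`|u z - u (i x)| - `|u w - u (i x)|) +
     a * (mdist (i x) w - mdist (i x) z))%R by rewrite /F; ring.
  apply: (le_trans (ler_normD _ _)); rewrite [leRHS]mulrDl; apply: lerD.
    apply: le_trans (ler_dist_dist _ _) _.
    by rewrite opprB addrA subrK; exact: uL.
  rewrite normrM ler_wpM2l// ler_norml.
  have := metric_triangle (i x) z w; have := metric_triangle (i x) w z.
  by rewrite (metric_sym w z); lra.
have Fy : (0 < F y)%R.
  rewrite subr_gt0 /a mulrBl divfK ?gt_eqF//.
  by rewrite ltrBlDr ltrDl mulr_gt0.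
have [x' [xx' Fx']] := dense_meets
  (openI (open_metric_ball (i x) e) oF) (conj xy Fy).
rewrite /F/= i_isom subr_gt0 in Fx'.
have xDx' : x' <> x.
  by move=> xE; move: Fx'; rewrite xE subrr normr0 mdistxx mulr0 ltxx.
have d'0 : (0 < mdist x x')%R by rewrite mdist_gt0; apply/eqP => /esym.
apply: (le_trans _ (slope_ge _ (_ : ball x e x') xDx')); last first.
  by rewrite -preimage_ball.
by rewrite lee_fin ler_pdivlMr// ltW.
Qed.

Lemma lip_completion (u : Y -> R) (x : X) : lipschitz_fun u ->
  lip u (i x) = lip (u \o i) x.
Proof.
move=> /lipschitz_funP[L L0 uL].
have := @cvg_scale_slope R Y u (i x).
rewrite (_ : (fun k => _) = (fun k => scale_slope (u \o i) k.+1%:R^-1 x)).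
    move=> h; apply: (cvg_unique (@ereal_hausdorff R) h).
  exact: cvg_scale_slope.
by apply/funext => k; rewrite /scale_slope (slope_completion _ _ L0 uL).
Qed.

Lemma lipschitz_comp_isometry (u : Y -> R) : lipschitz_fun u ->
  lipschitz_fun (u \o i).
Proof. by move=> [L uL]; exists L => x y; rewrite -i_isom; exact: uL. Qed.

Lemma lipschitz_extension (u : X -> R) : lipschitz_fun u ->
  exists2 v : Y -> R, lipschitz_fun v & v \o i = u.
Proof.
move=> /lipschitz_funP[L L0 uL].
have uL' x y : (u x - u y <= L * mdist (i x) (i y))%R.
  by rewrite i_isom (le_trans (ler_norm _)).
have [v vL vu] := @mcshane_extension R Y X i u L point L0 uL'.
by exists v; [exists L|exact/funext].
Qed.

Lemma poincare_on_completion (p K : R) (y : Y) (r r' : R) (u : Y -> R) :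
  lipschitz_fun u ->
  poincare_on nu p K y r r' u (lip u) <->
  oscillation m (i @^-1` ball y r) (u \o i) <=
    K%:E * avg m (i @^-1` ball y r') (fun x => lip (u \o i) x `^ p) `^ p^-1.
Proof.
move=> lipu; rewrite /poincare_on.
have mB s := ball_cara completion_borel_cara y s.
have mu' := borel_fun_cara completion_borel_cara (lipschitz_borel lipu) (mB r).
have mg : measurable_fun (ball y r' : set (caratheodory_type nu))
    (fun z => lip u z `^ p).
  apply: (measurableT_comp (measurable_poweR _)).
  exact: (borel_fun_cara completion_borel_cara (lip_borel lipu)).
rewrite (oscillation_completion (mB r) mu') (avg_completion (mB r') mg).
have -> : (fun z => lip u z `^ p) \o i = (fun x => lip (u \o i) x `^ p).
  by apply/funext => x /=; rewrite lip_completion.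
by [].
Qed.

Lemma poincare_completion_restrict (p K lambda : R) :
  (forall (v : Y -> R), lipschitz_fun v -> forall y (r : R), (0 < r)%R ->
    poincare_on nu p (K * r) y r (lambda * r) v (lip v)) ->
  forall (u : X -> R), lipschitz_fun u -> forall x (r : R), (0 < r)%R ->
    poincare_on mu p (K * r) x r (lambda * r) u (lip u).
Proof.
move=> piY u /lipschitz_extension[v lipv <-] x r r0.
have := piY v lipv (i x) r r0.
by rewrite poincare_on_completion// !preimage_ball.
Qed.

(** The centre y is replaced by points c_k of X at distance less than delta_k
    and the radius r by r - delta_k.  The triangle inequality keeps the balls of
    radius s * (r - delta_k) inside the one of radius s * r exactly because
    s >= 1, which covers both s = 1 and s = lambda. *)
Lemma poincare_completion_extend (p K lambda : R) :
  (0 < p)%R -> (0 <= K)%R -> (1 <= lambda)%R ->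
  (forall (u : X -> R), lipschitz_fun u -> forall x (r : R), (0 < r)%R ->
    poincare_on mu p (K * r) x r (lambda * r) u (lip u)) ->
  forall (v : Y -> R), lipschitz_fun v -> forall y (r : R), (0 < r)%R ->
    poincare_on nu p (K * r) y r (lambda * r) v (lip v).
Proof.
move=> p0 K0 l1 piX v lipv y r r0.
have bv := lipschitz_borel lipv.
have [B0|] := eqVneq (nu (ball y r)) 0.
  by apply: (poincare_on_null completion_borel_cara) => //; rewrite mulr_ge0// ltW.
rewrite neq_lt ltNge outer_measure_ge0/= => B0.
apply/poincare_on_completion => //; set u := v \o i.
have lipu : lipschitz_fun u by exact: lipschitz_comp_isometry.
have [L L0 vL] := lipschitz_funP lipv.
have [L' L'0 uL] := lipschitz_funP lipu.
have l0 : (0 < lambda)%R by exact: lt_le_trans l1.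
pose del (k : nat) := (r / 2 * k.+1%:R^-1)%R.
have r20 : (0 < r / 2)%R by rewrite divr_gt0.
have del0 k : (0 < del k)%R by rewrite mulr_gt0// invr_gt0.
have delr k : (del k < r)%R.
  have : (del k <= r / 2)%R.
    by rewrite /del ler_piMr ?(ltW r20)// invf_le1// ler1n.
  lra.
have cvgdel : del k @[k --> \oo] --> 0%R.
  by rewrite -(mulr0 (r / 2)%R); apply: cvgMr; exact: cvg_harmonic.
have neardel (t : R) : (0 < t)%R -> \forall k \near \oo, (del k < t)%R.
  by move=> t0; exact: cvgr_lt cvgdel _ t0.
have /choice[c cP] : forall k, exists x, (mdist (i x) y < del k)%R.
  by move=> k; exact: dense_pointP.
pose rad k := (r - del k)%R.
have rad0 k : (0 < rad k)%R by rewrite subr_gt0.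
have sub (s : R) k : (1 <= s)%R ->
    ball (c k) (s * rad k) `<=` i @^-1` ball y (s * r).
  move=> s1 x; rewrite /= !ballEmdist/= => cx.
  have := metric_triangle y (i (c k)) (i x); rewrite i_isom (metric_sym y (i (c k))).
  have := cP k; move: cx; rewrite /rad.
  have : (1 * del k <= s * del k)%R by rewrite ler_wpM2r// ltW.
  lra.
have exh (s : R) : (1 <= s)%R -> forall x, (i @^-1` ball y (s * r)) x ->
    \forall k \near \oo, ball (c k) (s * rad k) x.
  move=> s1 x; rewrite /= ballEmdist/= => yx.
  have s0 : (0 < 1 + s)%R by lra.
  have : (0 < (s * r - mdist y (i x)) / (1 + s))%R by rewrite divr_gt0// subr_gt0.
  move=> /neardel; apply: filterS => k; rewrite ltr_pdivlMr// => dk.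
  rewrite ballEmdist/= -i_isom.
  have := metric_triangle (i (c k)) y (i x); have := cP k.
  rewrite /rad; lra.
have mB k s := ball_cara borel_cara (c k) s.
have mP (s : R) : measurable (i @^-1` ball y s : set (caratheodory_type mu)).
  apply: borel_cara; apply: sub_sigma_algebra; apply: preimage_open.
  exact: open_metric_ball.
have lipL x : lip u x <= L'%:E.
  by apply: (lip_le _ ltr01) => // z _; rewrite distrC.
have blip := lip_borel lipu; have bu := lipschitz_borel lipu.
have ib (s b : R) : (0 <= b)%R ->
    m.-integrable (i @^-1` ball y s) (cst b%:E).
  move=> b0; apply/integrableP; split; first exact: measurable_cst.
  have -> : \int[m]_(x in i @^-1` ball y s) `|cst b%:E x| =
      b%:E * m (i @^-1` ball y s).
    by rewrite -integral_cst//; apply: eq_integral => x _ /=; rewrite ger0_norm.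
  rewrite lte_mul_pinfty ?lee_fin//; exact: completion_ball_fin.
have r1 : (i @^-1` ball y r) = i @^-1` ball y (1 * r) by rewrite mul1r.
apply: (@poincare_limit _ _ _ m (i @^-1` ball y r) (i @^-1` ball y (lambda * r))
  (fun k => ball (c k) (rad k)) (fun k => ball (c k) (lambda * rad k))
  _ (mP _) _ _ _ (mP _) _ _ _ B0 _ (K * r)%R p (fun=> u) u
  (cst (`|v y| + L * r)%:E) (fun=> lip u) (lip u) (cst (L' `^ p)%:E)) => //.
- by move=> k; have := @sub 1%R k (lexx _); rewrite !mul1r.
- move=> x yx; have := exh 1%R (lexx _) x; rewrite mul1r => /(_ yx).
  by apply: filterS => k; rewrite mul1r.
- by move=> k; exact: sub.
- exact: exh.
- move=> x /=; apply: le_ball; exact: ler_peMl (ltW r0) l1.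
- exact: completion_ball_fin.
- by rewrite mulr_ge0// ltW.
- by move=> _; exact: (borel_fun_cara borel_cara).
- exact: (borel_fun_cara borel_cara).
- by apply: aeW => x _; exact: cvg_cst.
- by apply: ib; rewrite addr_ge0// mulr_ge0// ltW.
- by apply: nearW => k x yx; rewrite lee_fin (lipschitz_bounded_ball L0 vL yx).
- by move=> _; exact: (borel_fun_cara borel_cara).
- exact: (borel_fun_cara borel_cara).
- by apply: aeW => x _; exact: cvg_cst.
- by apply: ib; exact: powR_ge0.
- apply: nearW => k x _; rewrite -poweR_EFin; apply: le_poweR => //.
  + exact: ltW.
  + exact: lip_ge0.
apply: nearW => k; apply: le_trans (piX u lipu (c k) (rad k) (rad0 k)) _.
apply: lee_wpmul2r; first exact: poweR_ge0.
by rewrite lee_fin ler_wpM2l// gerBl ltW.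
Qed.

End completion.

(** * The equivalence *)

Theorem corollary7p1 (R : realType) (p : R) (X : pmetricType R)
    (mu : {outer_measure set X -> \bar R}) :
  1 <= p -> metric_measure_space mu ->
  (forall C lambda : R,
     poincare mu p lip_couples C lambda <-> poincare mu p UG_couples C lambda)
  /\
  (forall (Y : completeMetricType R) (i : X -> Y), is_completion i ->
     (exists C lambda : R, poincare mu p lip_couples C lambda) <->
     (exists C lambda : R,
        poincare (completion_measure mu i) p lip_couples C lambda)).
Proof.
move=> p1 mmsX; have p0 : 0 < p by exact: lt_le_trans p1.
have borel_cara := radon_borel (mms_radon mmsX).
have ball_fin (x : X) (r : R) : (mu (ball x r) < +oo)%E.
  exact: (mms_bounded mmsX (A := ball x r) (fun _ h => h)).
have radii (l r : R) : 1 <= l -> 0 < r -> r <= l * r.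
  by move=> l1 r0; exact: ler_peMl (ltW r0) l1.
split=> [C l|Y i [i_isom i_dense]].
  split=> -[C1 l1 pi]; split=> // u g ug x r r0.
  - apply: (poincare_UG_of_lip borel_cara ball_fin p0 _ (radii _ _ l1 r0) ug).
      by rewrite mulr_gt0// (lt_le_trans ltr01).
    by move=> w lipw; exact: (pi w (lip w)).
  - case: ug => /= lipu ->.
    apply: (poincare_lip_of_UG borel_cara ball_fin p0 _ (radii _ _ l1 r0) lipu).
      by rewrite mulr_ge0 ?(ltW r0)// (le_trans ler01).
    move=> e e' e'0 e'e; apply: (pi u (scale_slope u e)) => //; split => /=.
      exact: lipschitz_borel.
    have [L L0 uL] := lipschitz_funP lipu.
    by exists e' => //; exact: scale_slope_UG uL.
split=> -[C [l [C1 l1 pi]]]; exists C, l; split=> // u g [/= lipu ->] x r r0.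
- apply: (poincare_completion_extend borel_cara ball_fin i_isom i_dense p0 _ l1 _
    lipu x r0).
    exact: le_trans C1.
  by move=> v lipv y s s0; exact: (pi v (lip v)).
- apply: (poincare_completion_restrict borel_cara i_isom i_dense _
    lipu x r0).
  by move=> v lipv y s s0; exact: (pi v (lip v)).
Qed.
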